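(* Let $D$ be a linear differential operator of order $k\ge0$, and let $K(\mathbf{x},\mathbf{y})=\Phi_{\mathrm{PHS},\nu}(\mathbf{x}-\mathbf{y})$, $\mathbf{x},\mathbf{y}\in\mathbb{R}^d$, where $\Phi_{\mathrm{PHS},\nu}(\mathbf{x}):=(-1)^{\lceil\nu/2\rceil}\|\mathbf{x}\|_2^\nu$ for some real $\nu>2k$ that is not an even positive integer, and let $s\ge\lceil\nu/2\rceil$ be an integer. Let $\mathbf{z}\in\mathbb{R}^d$ and let $\mathbf{X}=\{\mathbf{x}_1,\ldots,\mathbf{x}_N\}\subset\mathbb{R}^d$ be a finite set of (distinct) points, and assume that there is at least one $w\in\mathbb{R}^N$ with $\sum_{j=1}^Nw_jp(\mathbf{x}_j)=Dp(\mathbf{z})$ for all $p\in\Pi^d_s$. Let $w^*$ be the weight vector of the kernel-based numerical differentiation formula for $D$, $K$, $s$, $\mathbf{z}$, $\mathbf{X}$. Then for all $f\in\mathcal{F}_K$, $$\Big|Df(\mathbf{z})-\sum_{j=1}^Nw_j^*f(\mathbf{x}_j)\Big|\le\rho_{s,D}\big(\mathbf{z},\mathbf{X},\tfrac{\nu}{2}\big)\,C_{d,r}^{1/2}\,|\Phi_{\mathrm{PHS},\nu}|_{C^{r,\gamma}(B_{\mathbf{z},\mathbf{X}})}^{1/2}\,\|f\|_K,$$ where $r=\lceil\nu\rceil-1$, $\gamma=\nu-r$, and $$C_{d,r}=\begin{cases}\dfrac{2d^{r/2}}{(\gamma/2+1)^2\cdots(\gamma/2+\lfloor r/2\rfloor)^2}&\text{if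 } r \text{ is even},\\[2mm]\dfrac{d^{r/2}}{((1+\gamma)/2+1)^2\cdots((1+\gamma)/2+\lfloor r/2\rfloor)^2}&\text{if } r\text{ is odd}\end{cases}$$ (an empty product being $1$).
   Context: Notation. $\Pi^d_q$ is the space of $d$-variate real polynomials of total degree at most $q-1$. $S_{\mathbf{z},\mathbf{X}}:=\bigcup_{i=1}^N[\mathbf{z},\mathbf{x}_i]$ is the union of closed line segments, and $B_{\mathbf{z},\mathbf{X}}$ is the closed ball in $\mathbb{R}^d$ centered at the origin with radius equal to the diameter of $S_{\mathbf{z},\mathbf{X}}$. Differential operator: $Df=\sum_{|\alpha|\le k}a_\alpha\partial^\alpha f$ with real variable coefficients $a_\alpha$ (functions). $D'K$ denotes $D$ applied to the first $d$-dimensional argument of $K$. Hölder space. For an integer $r\ge0$ and $0<\gamma\le1$, $C^{r,\gamma}(\Omega)$ consists of all $r$ times continuously differentiable functions $f$ on $\Omega\subset\mathbb{R}^d$ with $|f|_{C^{r,\gamma}(\Omega)}:=\max_{|\alpha|=r}|\partial^\alpha f|_{C^{0,\gamma}(\Omega)}<\infty$, where $|g|_{C^{0,\gamma}(\Omega)}:=\sup_{\mathbf{x},\mathbf{y}\in\Omega,\,\mathbf{x}\ne\mathbf{y}}|g(\mathbf{x})-g(\mathbf{y})|/\|\mathbf{x}-\mathbf{y}\|_2^\gamma$. Known fact: for $s\ge\lceil\nu/2\rceil$ the kernel $K$ is conditionally positive definite of order $s$ on $\mathbb{R}^d$, i.e. $\sum_{i,j=1}^na_ia_jK(\mathbf{y}_i,\mathbf{y}_j)>0$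 for all pairwise distinct $\mathbf{y}_1,\ldots,\mathbf{y}_n\in\mathbb{R}^d$ and all $a\in\mathbb{R}^n\setminus\{0\}$ with $\sum_ja_jp(\mathbf{y}_j)=0$ for all $p\in\Pi^d_s$. Kernel-based formula. Let $p_1,\ldots,p_M$ be a basis of $\Pi^d_s$, $M=\binom{d+s-1}{d}$. The weight vector $w^*$ is the $w$-part of a solution $(w,v)\in\mathbb{R}^N\times\mathbb{R}^M$ of $$\sum_{j=1}^N w_jK(\mathbf{x}_i,\mathbf{x}_j)+\sum_{j=1}^M v_jp_j(\mathbf{x}_i)=D'K(\mathbf{z},\mathbf{x}_i)\ (1\le i\le N),\qquad \sum_{j=1}^N w_jp_i(\mathbf{x}_j)=Dp_i(\mathbf{z})\ (1\le i\le M).$$ It is known that if the second group of equations is consistent, then the whole system is solvable and $w^*$ is uniquely determined ($v$ may be non-unique). Native space. $\mathcal{F}_K$ (for the chosen order $s$) is the semi-Hilbert space of real-valued functions on $\mathbb{R}^d$ obtained as completion of the space of functions $\sum_ia_iK(\cdot,\mathbf{y}_i)+p$ (finite sums, $p\in\Pi^d_s$, $\sum_ia_iq(\mathbf{y}_i)=0$ for all $q\in\Pi^d_s$) with squared semi-norm $\|\sum_ia_iK(\cdot,\mathbf{y}_i)+p\|_K^2=\sum_{i,j}a_ia_jK(\mathbf{y}_i,\mathbf{y}_j)$; polynomials in $\Pi^d_s$ have semi-norm zero. Equivalently, $f:\mathbb{R}^d\to\mathbb{R}$ belongs to $\mathcal{F}_K$ with $\|f\|_K\le C$ iff $|\sum_ia_if(\mathbf{y}_i)|\le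 C(\sum_{i,j}a_ia_jK(\mathbf{y}_i,\mathbf{y}_j))^{1/2}$ for all finite sets of points $\mathbf{y}_i$ and coefficients $a_i$ with $\sum_ia_iq(\mathbf{y}_i)=0$ for all $q\in\Pi^d_s$. Growth function. For $\mu\ge0$, $\rho_{q,D}(\mathbf{z},\mathbf{X},\mu):=\sup\{Dp(\mathbf{z}):p\in\Pi^d_q,\ |p(\mathbf{x}_j)|\le\|\mathbf{x}_j-\mathbf{z}\|_2^\mu,\ j=1,\ldots,N\}\in[0,\infty]$; if it equals $\infty$ the bound is void. *)

(* Defs.v *)
(* MathComp-Analysis over an abstract R : realType, together with the
   multivariate polynomials of multinomials.  R^d is 'rV[R]_d. *)
From HB Require Import structures.
From mathcomp Require Import all_boot all_order all_algebra.
From mathcomp Require Import all_classical all_reals all_analysis.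
(* The notations of mpoly clash with those of MathComp-Analysis and are left
   out: [mpoly d R] is {mpoly R[d]}, [multinom d] is 'X_{1..d} (multi-indices)
   and [bmultinom d k] is 'X_{1..d < k} (multi-indices of length < k). *)
From mathcomp Require Import -(notations) mpoly.
Set Implicit Arguments.
Unset Strict Implicit.
Unset Printing Implicit Defensive.
Import Order.TTheory GRing.Theory Num.Theory numFieldNormedType.Exports.
Local Open Scope classical_set_scope.
Local Open Scope ring_scope.

Section Euclidean.
Context {R : realType} {d : nat}.
Implicit Types (x y z : 'rV[R]_d) (A : set 'rV[R]_d).

(* `|x| on 'rV[R]_d is the maximum norm, hence this definition. *)
Definition enorm x : R := Num.sqrt (\sum_(i < d) x ord0 i ^+ 2).

Definition diam A : R :=
  sup [set t | exists x y, [/\ A x, A y & t = enorm (x - y)]].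

Definition segment x y : set 'rV[R]_d :=
  [set u | exists t : R, 0 <= t <= 1 /\ u = (1 - t) *: x + t *: y].

Definition star N z (X : 'I_N -> 'rV[R]_d) : set 'rV[R]_d :=
  [set u | exists i : 'I_N, segment z (X i) u].

Definition origin_ball N z (X : 'I_N -> 'rV[R]_d) : set 'rV[R]_d :=
  [set u | enorm u <= diam (star z X)].

End Euclidean.

Section Derivatives.
Context {R : realType} {d : nat}.
Implicit Types (f g : 'rV[R]_d -> R) (z : 'rV[R]_d) (Omega : set 'rV[R]_d).

Definition partial (i : 'I_d) f : 'rV[R]_d -> R :=
  fun x => 'D_(delta_mx ord0 i) f x.

Definition mpartial (alpha : multinom d) f : 'rV[R]_d -> R :=
  foldr (fun i g => iter (alpha i) (partial i) g) f (enum 'I_d).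

(* Only the values a alpha with |alpha| <= k matter. *)
Definition diffop (k : nat) (a : multinom d -> 'rV[R]_d -> R) f :
    'rV[R]_d -> R :=
  fun x => \sum_(alpha : bmultinom d k.+1) a alpha x * mpartial alpha f x.

(* The maximum with 0 fixes the supremum over an empty set of pairs, which in
   \bar R would be -oo. *)
Definition holder0 (gamma : R) Omega g : \bar R :=
  maxe 0%E (ereal_sup [set t | exists x y, [/\ Omega x, Omega y, x != y &
    t = (`|g x - g y| / enorm (x - y) `^ gamma)%:E]]).

(* For f defined on the whole space; derivatives are taken there and then
   restricted to Omega. *)
Definition holder (r : nat) (gamma : R) Omega f : \bar R :=
  \big[maxe/0%E]_(alpha : bmultinom d r.+1 | mdeg alpha == r)
    holder0 gamma Omega (mpartial alpha f).

End Derivatives.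

Section Polynomials.
Context {R : realType} {d : nat}.

(* msize is the total degree plus 1, and 0 for the zero polynomial. *)
Definition Pi_ (q : nat) : set (mpoly d R) := [set p | (msize p <= q)%N].

Definition pfun (p : mpoly d R) : 'rV[R]_d -> R := fun x => meval (x ord0) p.

Definition basis_Pi (q M : nat) (b : 'I_M -> mpoly d R) : Prop :=
  [/\ forall i, Pi_ q (b i),
      forall p, Pi_ q p -> exists c : 'I_M -> R, p = \sum_(i < M) c i *: b i &
      forall c : 'I_M -> R, \sum_(i < M) c i *: b i = 0 -> forall i, c i = 0].

Definition growth (q k N : nat) (a : multinom d -> 'rV[R]_d -> R)
    (z : 'rV[R]_d) (X : 'I_N -> 'rV[R]_d) (mu : R) : \bar R :=
  ereal_sup [set t | exists p : mpoly d R, [/\ Pi_ q p,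
    forall j, `|pfun p (X j)| <= enorm (X j - z) `^ mu &
    t = (diffop k a (pfun p) z)%:E]].

End Polynomials.

Section Kernels.
Context {R : realType} {d : nat}.
Implicit Types (K : 'rV[R]_d -> 'rV[R]_d -> R) (f : 'rV[R]_d -> R).

Definition phs (nu : R) (x : 'rV[R]_d) : R :=
  (-1) ^ Num.ceil (nu / 2) * enorm x `^ nu.

Definition phs_kernel (nu : R) (x y : 'rV[R]_d) : R := phs nu (x - y).

Definition kernel_weights (k N M : nat) (a : multinom d -> 'rV[R]_d -> R)
    K (z : 'rV[R]_d) (X : 'I_N -> 'rV[R]_d) (b : 'I_M -> mpoly d R)
    (w : 'I_N -> R) : Prop :=
  exists v : 'I_M -> R,
    (forall i : 'I_N,
       \sum_(j < N) w j * K (X i) (X j) + \sum_(j < M) v j * pfun (b j) (X i)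
       = diffop k a (fun x => K x (X i)) z) /\
    (forall i : 'I_M,
       \sum_(j < N) w j * pfun (b i) (X j) = diffop k a (pfun (b i)) z).

(* A list of pairs (a_i, y_i) encodes the functional f |-> \sum_i a_i f(y_i)
   and the function \sum_i a_i K(., y_i). *)
Definition fsupp := seq (R * 'rV[R]_d).

Definition fapply (l : fsupp) f : R := \sum_(c <- l) c.1 * f c.2.

Definition annihilates (s : nat) (l : fsupp) : Prop :=
  forall q, Pi_ s q -> fapply l (pfun q) = 0.

Definition ksum K (l : fsupp) : 'rV[R]_d -> R :=
  fun x => \sum_(c <- l) c.1 * K x c.2.

Definition ksqnorm K (l : fsupp) : R :=
  \sum_(c <- l) \sum_(c' <- l) c.1 * c'.1 * K c.2 c'.2.

Definition fsub (l l' : fsupp) : fsupp := l ++ [seq (- c.1, c.2) | c <- l'].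

(* The functions ksum K (l n) + p n form a Cauchy sequence for the semi-norm
   of the space to be completed, and converge pointwise to f. *)
Definition native_approx K (s : nat) f (l : nat -> fsupp)
    (p : nat -> mpoly d R) : Prop :=
  [/\ forall n, annihilates s (l n),
      forall n, Pi_ s (p n),
      forall e : R, 0 < e -> exists n0 : nat, forall m n : nat,
        (n0 <= m)%N -> (n0 <= n)%N ->
        Num.sqrt (ksqnorm K (fsub (l m) (l n))) < e &
      forall x, (fun n => ksum K (l n) x + pfun (p n) x) @ \oo --> f x].

(* Concrete completion as a space of functions: the pointwise limits of the
   Cauchy sequences, with the limit of the semi-norms (which does not depend
   on the sequence when K is conditionally positive definite of order s). *)
Definition native_space K (s : nat) : set ('rV[R]_d -> R) :=
  [set f | exists l p, native_approx K s f l p].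

Definition native_norm K (s : nat) f : R :=
  xget 0 [set c : R | exists l p, native_approx K s f l p /\
    (fun n => Num.sqrt (ksqnorm K (l n))) @ \oo --> c].

End Kernels.

Section Constant.
Context {R : realType}.

Definition Cdr (d r : nat) (gamma : R) : R :=
  if odd r then
    d%:R `^ (r%:R / 2) /
      \prod_(1 <= j < (r./2).+1) ((1 + gamma) / 2 + j%:R) ^+ 2
  else
    2 * d%:R `^ (r%:R / 2) /
      \prod_(1 <= j < (r./2).+1) (gamma / 2 + j%:R) ^+ 2.

End Constant.

(* Main.v *)
(** Write [n] for the integer part of [nu / 2], [K] for the kernel and [P] for
    the norm, in the dual of the native space, of the error functional
    [lambda f = Df(z) - \sum_j w_j f(x_j)].

    Conditional positivity of [K] follows from that of the Gaussians, since
    [r^(nu/2)] is a limit of positive combinations of functions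
    [(-1)^(n+1) (exp(-t r) - \sum_(j <= n) (-t r)^j / j!)] of [r].  It extends
    to functionals containing derivatives at [z] of order at most [n] by finite
    differences, corrected so as to annihilate polynomials; the pairings of two
    such derivatives disappear in the limit because [K] is homogeneous of degree
    [nu > 2 n].  Cauchy-Schwarz for this form gives the regularity of native
    functions and [|lambda f| <= P |f|].

    To bound [P], let [g = lambda^y K(., y)].  The linear system says that [g]
    equals some [p] in [Pi_s] on [X] and yields [P^2 = D(T - p)(z)], where [T] is
    a polynomial of degree [n] which agrees with [g] at [z] as far as [D] and the
    Taylor expansions towards the [x_j] are concerned.  Cauchy-Schwarz for
    [lambda] and the Taylor remainder functional at [x_j], whose squared norm is
    [2 binom(nu - 1, n) |x_j - z|^nu] by a computation along a line, bounds
    [(T - p)(x_j)] by [(2 binom(nu - 1, n))^(1/2) |x_j - z|^(nu/2) P], so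
    [(T - p)] is admissible for the growth function up to scaling, and
    [P <= (2 binom(nu - 1, n))^(1/2) rho].  Finally [2 binom(nu - 1, n)] is at
    most [C_(d,r)] times the Hoelder seminorm, already on a coordinate axis. *)

Require Import Defs.
From mathcomp Require Import all_boot all_order all_algebra.
From mathcomp Require Import all_classical all_reals all_analysis.
From mathcomp Require Import -(notations) mpoly.
From mathcomp Require Import ring lra.
Import Order.TTheory GRing.Theory Num.Theory numFieldNormedType.Exports.
Local Open Scope classical_set_scope.
Local Open Scope ring_scope.

Set Implicit Arguments.
Unset Strict Implicit.
Unset Printing Implicit Defensive.

Lemma cvgr_sum {R : realType} {T : Type} {F : set_system T} {FF : Filter F}
    (I : Type) (r : seq I) (P : pred I) (f : I -> T -> R) (a : I -> R) :
  (forall i, P i -> f i x @[x --> F] --> a i) ->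
  \sum_(i <- r | P i) f i x @[x --> F] --> \sum_(i <- r | P i) a i.
Proof. by move=> fa; apply: cvg_big fa => //; exact: add_continuous. Qed.

(** * Powers as limits of averages *)

Section MellinAverage.
Context {R : realType}.
Implicit Types (r x y sigma : R).

Section Geometric.
Variables (psi : R -> R) (j : nat) (A sigma d : R).
Hypothesis psi_ge0 : forall u, 0 <= u -> 0 <= psi u.
Hypothesis psi_homo : forall u v, 0 <= u -> u <= v -> psi u <= psi v.
Hypothesis psi_le_small : forall u, 0 <= u -> psi u <= A * u ^+ j.+1.
Hypothesis psi_le_large : forall u, 0 <= u -> psi u <= A * u ^+ j.
Hypothesis psi1_gt0 : 0 < psi 1.
Hypothesis (j_lt : j%:R < sigma) (lt_j : sigma < j.+1%:R) (d_gt0 : 0 < d).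

(** Up to normalisation, the terms of index [i] and [- i] of a Riemann sum, with step [d] in the
    variable ln t, for the Mellin integral of psi(t r) against t^(- sigma) dt / t, which is
    proportional to r^sigma. *)
Definition mellin_up r (i : nat) :=
  expR (- (d * sigma * i%:R)) * psi (expR (d * i%:R) * r).
Definition mellin_down r (i : nat) :=
  expR (d * sigma * i%:R) * psi (expR (- (d * i%:R)) * r).
Local Notation up := mellin_up.
Local Notation down := mellin_down.

Lemma mellin_up_ge0 r i : 0 <= r -> 0 <= up r i.
Proof. by move=> r0; rewrite mulr_ge0 ?expR_ge0 ?psi_ge0 ?mulr_ge0 ?expR_ge0. Qed.

Lemma mellin_down_ge0 r i : 0 <= r -> 0 <= down r i.
Proof. by move=> r0; rewrite mulr_ge0 ?expR_ge0 ?psi_ge0 ?mulr_ge0 ?expR_ge0. Qed.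

(** Domination by a geometric series of ratio [expR (d * (j%:R - sigma))], which is below 1 by
    [j_lt]. The downward terms are treated in the same way with the other bound on [psi] and
    [lt_j]. *)
Lemma is_cvg_mellin_up r : 0 <= r -> cvgn (series (up r)).
Proof.
move=> r0; pose v := geometric (A * r ^+ j) (expR (d * (j%:R - sigma))).
have le_v i : up r i <= v i.
  rewrite (le_trans (ler_wpM2l (expR_ge0 _) (psi_le_large _)))//.
    by rewrite mulr_ge0 ?expR_ge0.
  rewrite /v /geometric/= exprMn -!expRM_natr.
  rewrite (_ : d * (j%:R - sigma) * _ = - (d * sigma * i%:R) + d * i%:R * j%:R); last by ring.
  by rewrite expRD le_eqVlt; apply/orP; left; apply/eqP; ring.
apply: (@series_le_cvg _ _ v) => [i|i|//|].
- exact: mellin_up_ge0.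
- exact: le_trans (mellin_up_ge0 i r0) (le_v i).
apply: is_cvg_geometric_series; rewrite ger0_norm ?expR_ge0// expR_lt1.
by rewrite pmulr_rlt0// subr_lt0.
Qed.

Lemma is_cvg_mellin_down r : 0 <= r -> cvgn (series (fun i => down r i.+1)).
Proof.
move=> r0.
pose q := expR (d * (sigma - j.+1%:R)).
pose v := geometric (A * r ^+ j.+1 * q) q.
have le_v i : down r i.+1 <= v i.
  rewrite (le_trans (ler_wpM2l (expR_ge0 _) (psi_le_small _)))//.
    by rewrite mulr_ge0 ?expR_ge0.
  rewrite /v /geometric/= -[leRHS]mulrA -exprS exprMn -!expRM_natr.
  rewrite (_ : d * (sigma - j.+1%:R) * _ =
    d * sigma * i.+1%:R + (- (d * i.+1%:R)) * j.+1%:R); last by ring.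
  by rewrite expRD le_eqVlt; apply/orP; left; apply/eqP; ring.
apply: (@series_le_cvg _ _ v) => [i|i|//|].
- exact: mellin_down_ge0.
- exact: le_trans (mellin_down_ge0 i.+1 r0) (le_v i).
apply: is_cvg_geometric_series; rewrite ger0_norm ?expR_ge0// expR_lt1.
by rewrite pmulr_rlt0// subr_lt0.
Qed.

Definition mellin_partial r n := \sum_(i < n) up r i + \sum_(i < n) down r i.+1.
Definition mellin r := limn (mellin_partial r).

Lemma cvg_mellin r : 0 <= r -> mellin_partial r @ \oo --> mellin r.
Proof.
move=> r0; apply/cvg_ex => /=.
exists (limn (series (up r)) + limn (series (fun i => down r i.+1))).
have -> : mellin_partial r = series (up r) + series (fun i => down r i.+1).
  by rewrite !seriesEord.
by apply: cvgD; [exact: is_cvg_mellin_up|exact: is_cvg_mellin_down].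
Qed.

(** Multiplying [r] by [expR d] shifts the two-sided sum by one index. On partial sums this costs
    two boundary terms, which tend to 0 as terms of convergent series. *)
Lemma mellinS r : 0 <= r -> mellin (expR d * r) = expR (d * sigma) * mellin r.
Proof.
move=> r0.
have r0' : 0 <= expR d * r by rewrite mulr_ge0 ?expR_ge0.
apply: (cvg_unique _ (cvg_mellin r0')) => //=.
have -> : mellin_partial (expR d * r) =
   (fun n => expR (d * sigma) * (mellin_partial r n + up r n - down r n)).
  apply/funext => n; rewrite /mellin_partial.
  have -> : \sum_(i < n) up (expR d * r) i =
      expR (d * sigma) * (\sum_(i < n) up r i + up r n - up r 0).
    have <- : \sum_(i < n.+1) up r i = \sum_(i < n) up r i + up r n.
      by rewrite big_ord_recr.
    rewrite big_ord_recl /= addrAC subrr add0r mulr_sumr; apply: eq_bigr => i _.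
    rewrite /up /bump /= [in RHS]mulrA -expRD [expR _ * (expR d * r)]mulrA -expRD.
    by congr (expR _ * psi (expR _ * r)); rewrite add1n -natr1; ring.
  have -> : \sum_(i < n) down (expR d * r) i.+1 =
      expR (d * sigma) * (\sum_(i < n) down r i.+1 + down r 0 - down r n).
    have -> : \sum_(i < n) down r i.+1 + down r 0 = \sum_(i < n) down r i + down r n.
      have <- : \sum_(i < n.+1) down r i = \sum_(i < n) down r i + down r n.
        by rewrite big_ord_recr.
      by rewrite big_ord_recl addrC.
    rewrite addrK mulr_sumr; apply: eq_bigr => i _.
    rewrite /down [in RHS]mulrA -expRD [expR _ * (expR d * r)]mulrA -expRD.
    by congr (expR _ * psi (expR _ * r)); rewrite -natr1; ring.
  have -> : up r 0 = down r 0 by rewrite /up /down !mulr0 oppr0.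
  ring.
apply: cvgMr.
rewrite -[X in _ --> X]addr0 -[X in _ --> X]subr0.
have up0 : up r @ \oo --> (0 : R).
  exact: cvg_series_cvg_0 (is_cvg_mellin_up r0).
have down0 : down r @ \oo --> (0 : R).
  by rewrite -(cvg_shiftS (down r)); exact: cvg_series_cvg_0 (is_cvg_mellin_down r0).
by apply: cvgB => //; apply: cvgD => //; exact: cvg_mellin.
Qed.

Lemma mellin_int r (k : int) : 0 <= r ->
  mellin (expR (d * k%:~R) * r) = expR (d * sigma * k%:~R) * mellin r.
Proof.
have nat_case (n : nat) x : 0 <= x ->
    mellin (expR (d * n%:R) * x) = expR (d * sigma * n%:R) * mellin x.
  elim: n x => [|n IHn] x x0; first by rewrite !mulr0 expR0 !mul1r.
  rewrite -natr1 !mulrDr !mulr1 !expRD -[X in mellin X]mulrA IHn ?mulr_ge0 ?expR_ge0//.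
  by rewrite mellinS// mulrA.
move=> r0; case: k => n; first exact: nat_case.
rewrite NegzE !mulrNz !mulrN.
have := @nat_case n.+1 (expR (- (d * n.+1%:R)) * r).
rewrite mulr_ge0 ?expR_ge0// mulrA -expRD subrr expR0 mul1r => -> //.
by rewrite mulrA -expRD addNr expR0 mul1r.
Qed.

Lemma mellin_homo : {in Num.nneg &, {homo mellin : x y / x <= y}}.
Proof.
move=> x y; rewrite !nnegrE => x0 y0 xy.
apply: (ler_cvg_to (cvg_mellin x0) (cvg_mellin y0)).
apply: nearW => n; apply: lerD; apply: ler_sum => i _;
  by rewrite ler_wpM2l ?expR_ge0// psi_homo ?mulr_ge0 ?ler_wpM2l ?expR_ge0.
Qed.

Lemma mellin1_gt0 : 0 < mellin 1.
Proof.
apply: (lt_le_trans psi1_gt0).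
apply: (cvgr_to_ge (cvg_mellin ler01)).
near=> n; rewrite /mellin_partial.
have n0 : (0 < n)%N by near: n; exact: nbhs_infty_gt.
rewrite -(prednK n0) big_ord_recl /= {1}/up !mulr0 oppr0 expR0 !mul1r -addrA lerDl.
by apply: addr_ge0; apply: sumr_ge0 => i _; [apply: mellin_up_ge0|apply: mellin_down_ge0].
Unshelve. all: by end_near. Qed.

(** The point [r] lies between two consecutive powers of [expR d]. By monotonicity and [mellin_int],
    both compared quantities lie in one interval whose endpoints differ by the factor
    [expR (d * sigma)]. *)
Lemma mellin_powR r : 0 < r ->
  `|mellin r / mellin 1 - r `^ sigma| <= r `^ sigma * (expR (d * sigma) - 1).
Proof.
move=> r0.
have m1 := mellin1_gt0.
pose k := Num.floor (ln r / d).
have s0 : 0 < sigma by rewrite (le_lt_trans _ j_lt)// ler0n.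
have k_le : d * k%:~R <= ln r by rewrite mulrC -ler_pdivlMr// floor_le.
have lt_k : ln r < d * (k + 1)%:~R by rewrite mulrC -ltr_pdivrMr// lt_succ_floor.
have rE : r = expR (ln r) by rewrite lnK.
have lo : expR (d * sigma * k%:~R) <= mellin r / mellin 1.
  rewrite ler_pdivlMr// -mellin_int// mulr1; apply: mellin_homo; rewrite ?nnegrE ?expR_ge0 ?(ltW r0)//.
  by rewrite [leRHS]rE ler_expR.
have hi : mellin r / mellin 1 <= expR (d * sigma * (k + 1)%:~R).
  rewrite ler_pdivrMr// -mellin_int// mulr1; apply: mellin_homo; rewrite ?nnegrE ?expR_ge0 ?(ltW r0)//.
  by rewrite [leLHS]rE ler_expR ltW.
have pE : r `^ sigma = expR (sigma * ln r) by rewrite /powR gt_eqF.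
have plo : expR (d * sigma * k%:~R) <= r `^ sigma.
  by rewrite pE ler_expR [d * sigma]mulrC -mulrA ler_wpM2l ?(ltW s0) ?(ltW lt_k)//.
have phi : r `^ sigma <= expR (d * sigma * (k + 1)%:~R).
  by rewrite pE ler_expR [d * sigma]mulrC -mulrA ler_wpM2l ?(ltW s0) ?(ltW lt_k)//.
have e1 : expR (d * sigma * (k + 1)%:~R) = expR (d * sigma * k%:~R) * expR (d * sigma).
  by rewrite -expRD; congr expR; rewrite intrD; ring.
have e2 : 1 <= expR (d * sigma) by rewrite -expR0 ler_expR mulr_ge0 ?ltW.
rewrite e1 in hi phi.
have e3 : expR (d * sigma * k%:~R) * (expR (d * sigma) - 1) <= r `^ sigma * (expR (d * sigma) - 1).
  by rewrite ler_wpM2r// subr_ge0.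
rewrite ler_norml; apply/andP; split; lra.
Qed.

Lemma mellin0 : psi 0 = 0 -> mellin 0 = 0.
Proof.
move=> psi0; have -> : mellin = fun r => limn (mellin_partial r) by [].
rewrite (_ : mellin_partial 0 = cst 0) ?lim_cst//; apply/funext => n.
by rewrite /mellin_partial /up /down !big1 ?addr0// => i _; rewrite mulr0 psi0 mulr0.
Qed.

End Geometric.

(* [powR ^~ sigma] is the limit, as [d] tends to 0, of the averages
   [\sum_(k in Z) expR (- (d * sigma * k)) * psi (expR (d * k) * r)], suitably
   normalised: they are monotone in [r] and homogeneous of degree [sigma] for
   the scalings by powers of [expR d]. *)
Lemma powR_sum_ge0 (psi : R -> R) (j : nat) (A sigma : R) (I : seq (R * R)) :
  (forall u v, 0 <= u -> u <= v -> psi u <= psi v) ->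
  psi 0 = 0 -> 0 < psi 1 ->
  (forall u, 0 <= u -> psi u <= A * u ^+ j.+1) ->
  (forall u, 0 <= u -> psi u <= A * u ^+ j) ->
  j%:R < sigma < j.+1%:R ->
  (forall p, p \in I -> 0 <= p.2) ->
  (forall t, 0 < t -> 0 <= \sum_(p <- I) p.1 * psi (t * p.2)) ->
  0 <= \sum_(p <- I) p.1 * p.2 `^ sigma.
Proof.
move=> homo psi0 psi1 small large /andP[jlt ltj] I0 T0.
have psi_ge0 u : 0 <= u -> 0 <= psi u by move=> u0; rewrite -psi0 homo.
have s0 : 0 < sigma by rewrite (le_lt_trans _ jlt)// ler0n.
set M := \sum_(p <- I) `|p.1| * p.2 `^ sigma.
have M0 : 0 <= M by apply: sumr_ge0 => p _; rewrite mulr_ge0 ?powR_ge0.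
have main e : 0 < e -> - (e * M) <= \sum_(p <- I) p.1 * p.2 `^ sigma.
  (* With this step size the relative error [expR (d * sigma) - 1] of [mellin_powR] is exactly
     [e]. *)
  move=> e0; pose d := ln (1 + e) / sigma.
  have d0 : 0 < d by rewrite divr_gt0// ln_gt0// ltrDl.
  have ds : expR (d * sigma) - 1 = e.
    by rewrite /d divfK ?gt_eqF// lnK ?posrE ?addr_gt0// addrAC subrr add0r.
  pose F := mellin psi sigma d.
  have F1 : 0 < F 1 by exact: (mellin1_gt0 psi_ge0 small large).
  have TF : 0 <= \sum_(p <- I) p.1 * F p.2.
    have cF : (fun n => \sum_(p <- I) p.1 * mellin_partial psi sigma d p.2 n) @ \oo
        --> \sum_(p <- I) p.1 * F p.2.
      rewrite [X in _ --> X]big_seq.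
      under eq_fun do rewrite big_seq.
      apply: cvgr_sum => p pI; apply: cvgMr; apply: (cvg_mellin psi_ge0 small large) => //.
      exact: I0.
    apply: (cvgr_to_ge cF).
    apply: nearW => n; rewrite /mellin_partial.
    under eq_bigr do rewrite mulrDr !mulr_sumr.
    rewrite big_split /= exchange_big /= addr_ge0//.
      apply: sumr_ge0 => i _; under eq_bigr do rewrite mulrCA.
      by rewrite -mulr_sumr mulr_ge0 ?expR_ge0// T0// expR_gt0.
    rewrite exchange_big /=.
    apply: sumr_ge0 => i _; under eq_bigr do rewrite mulrCA.
    by rewrite -mulr_sumr mulr_ge0 ?expR_ge0// T0// expR_gt0.
  have {}TF : 0 <= \sum_(p <- I) p.1 * (F p.2 / F 1).
    under eq_bigr do rewrite mulrA.
    by rewrite -mulr_suml divr_ge0// ltW.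
  rewrite -subr_ge0 opprK addrC; apply: (le_trans TF).
  rewrite /M mulr_sumr -big_split /= big_seq [leRHS]big_seq; apply: ler_sum => p pI.
  rewrite -lerBlDr -mulrBr (le_trans (ler_norm _))// normrM mulrCA ler_wpM2l//.
  have := I0 _ pI; rewrite le_eqVlt => /predU1P[<-|p0].
    by rewrite /F mellin0// powR0 ?gt_eqF// mul0r subr0 normr0 mulr0.
  rewrite [leRHS]mulrC.
  have := mellin_powR psi_ge0 homo small large psi1 jlt ltj d0 p0.
  by rewrite ds.
rewrite leNgt; apply/negP => neg.
pose T := \sum_(p <- I) p.1 * p.2 `^ sigma; rewrite -/T in neg main.
(* For this [e] the product [e * M] is less than [- T / 2], which contradicts [main]; the summand 1
   covers the case [M = 0]. *)
have e0 : 0 < - T / (2 * (M + 1)) by rewrite divr_gt0 ?oppr_gt0// mulr_gt0// ltr_pwDr.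
have := main _ e0; rewrite leNgt => /negP; apply.
have M1 : 0 < M + 1 by rewrite ltr_pwDr.
rewrite -mulNr -mulNr opprK mulrAC ltr_pdivlMr ?mulr_gt0//.
nra.
Qed.

End MellinAverage.

(** * Conditional positive definiteness *)

Section ExpRemainder.
Context {R : realType}.
Implicit Types (u v : R) (m : nat).

(** The Taylor remainder of exp(- u) at 0, with the sign that makes it positive for [u] > 0. In this
    form each remainder is the derivative of the next one, and nonnegativity of the next one is an
    upper bound for it. *)
Fixpoint exp_rem m u : R :=
  if m is m'.+1 then u ^+ m' / m'`!%:R - exp_rem m' u else expR (- u).

Lemma exp_remE m u :
  (-1) ^+ m * exp_rem m u = expR (- u) - \sum_(j < m) (- u) ^+ j / j`!%:R.
Proof.
elim: m => [|m IHm] /=; first by rewrite big_ord0 subr0 mul1r.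
rewrite big_ord_recr /= mulrBr exprS mulN1r !mulNr opprK IHm.
by rewrite [(- u) ^+ m]exprNn -mulrA; ring.
Qed.

Lemma exp_rem0 m : exp_rem m.+1 0 = 0.
Proof.
elim: m => [|m IHm]; first by rewrite /= oppr0 expR0 expr0 fact0 divr1 subrr.
by rewrite [LHS]/= -/(exp_rem m.+1 0) IHm expr0n mul0r subr0.
Qed.

Lemma is_derive_exp_rem m u : is_derive u 1 (exp_rem m.+1) (exp_rem m u).
Proof.
elim: m => [|m IHm].
  rewrite (_ : exp_rem 1 = cst 1 - expR \o -%R); last first.
    by apply/funext => x /=; rewrite fctE /= expr0 fact0 divr1.
  apply: is_derive_eq.
  by rewrite sub0r mulrN mulr1 opprK.
rewrite (_ : exp_rem m.+2 = (m.+1`!%:R^-1 \*: (id ^+ m.+1)) - exp_rem m.+1); last first.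
  by apply/funext => x; rewrite !fctE /= mulrC.
apply: is_derive_eq.
rewrite /GRing.scale /= mulr1; congr (_ - _).
by rewrite factS natrM invfM mulrA [X in X * _]mulrAC mulVf ?mul1r 1?mulrC// pnatr_eq0.
Qed.

Lemma exp_rem_gt0 m u : 0 < u -> 0 < exp_rem m u.
Proof.
elim: m u => [|m IHm] u u0; first exact: expR_gt0.
have [||c /andP[c0 _]] := @MVT R (exp_rem m.+1) (exp_rem m) 0 u u0.
- by move=> x _; exact: is_derive_exp_rem.
- apply: continuous_subspaceT => x; apply/differentiable_continuous/derivable1_diffP.
  by have [] := is_derive_exp_rem m x.
by rewrite exp_rem0 !subr0 => ->; rewrite mulr_gt0// IHm.
Qed.

Lemma exp_rem_homo m u v : 0 <= u -> u <= v -> exp_rem m.+1 u <= exp_rem m.+1 v.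
Proof.
move=> u0; rewrite le_eqVlt => /predU1P[->//|uv].
have [||c /andP[uc _]] := @MVT R (exp_rem m.+1) (exp_rem m) u v uv.
- by move=> x _; exact: is_derive_exp_rem.
- apply: continuous_subspaceT => x; apply/differentiable_continuous/derivable1_diffP.
  by have [] := is_derive_exp_rem m x.
move=> e; rewrite -subr_ge0 e mulr_ge0 ?subr_ge0 ?(ltW uv)//.
by rewrite ltW// exp_rem_gt0// (le_lt_trans u0).
Qed.

Lemma exp_rem_ge0 m u : 0 <= u -> 0 <= exp_rem m u.
Proof.
rewrite le_eqVlt => /predU1P[<-|/(exp_rem_gt0 m)/ltW//].
by case: m => [|m]; [exact: expR_ge0|rewrite exp_rem0].
Qed.

Lemma exp_rem_le m u : 0 <= u -> exp_rem m u <= u ^+ m / m`!%:R.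
Proof. by move=> u0; rewrite -subr_ge0; exact: (exp_rem_ge0 m.+1). Qed.

Lemma exp_remS_le m u : 0 <= u -> exp_rem m.+1 u <= u ^+ m / m`!%:R.
Proof. by move=> u0 /=; rewrite lerBlDr lerDl exp_rem_ge0. Qed.

End ExpRemainder.

(** * Positivity of Gaussians and of powers of the distance *)

Section ConditionalPositivity.
Context {R : realType} {d : nat}.
Implicit Types (x y : 'rV[R]_d) (l : @fsupp R d) (K : 'rV[R]_d -> 'rV[R]_d -> R).

Definition kform K l l' : R := \sum_(c <- l) \sum_(c' <- l') c.1 * c'.1 * K c.2 c'.2.

Definition dot x y : R := \sum_(i < d) x ord0 i * y ord0 i.

Definition sqn x : R := \sum_(i < d) x ord0 i ^+ 2.

Lemma sqn_ge0 x : 0 <= sqn x.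
Proof. by apply: sumr_ge0 => i _; exact: sqr_ge0. Qed.

Lemma enorm_powR x (nu : R) : enorm x `^ nu = sqn x `^ (nu / 2).
Proof. by rewrite /enorm -powR12_sqrt ?sqn_ge0// -powRrM mulrC. Qed.

Lemma sqnB x y : sqn (x - y) = sqn x + sqn y - 2 * dot x y.
Proof.
rewrite /sqn /dot mulr_sumr -big_split -sumrB; apply: eq_bigr => i _ /=.
by rewrite !mxE; ring.
Qed.

(** One factor [dot] is expanded into coordinates, and each coordinate is absorbed into the weight;
    this is why the weight [phi] is arbitrary. *)
Lemma dot_exp_psd j (phi : 'rV[R]_d -> R) l :
  0 <= \sum_(c <- l) \sum_(c' <- l)
    (c.1 * phi c.2) * (c'.1 * phi c'.2) * dot c.2 c'.2 ^+ j.
Proof.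
elim: j phi => [|j IHj] phi.
  under eq_bigr do under eq_bigr do rewrite expr0 mulr1.
  under eq_bigr do rewrite -mulr_sumr.
  by rewrite -mulr_suml -expr2 sqr_ge0.
have -> : \sum_(c <- l) \sum_(c' <- l)
    (c.1 * phi c.2) * (c'.1 * phi c'.2) * dot c.2 c'.2 ^+ j.+1 =
  \sum_(i < d) \sum_(c <- l) \sum_(c' <- l)
    (c.1 * (phi c.2 * c.2 ord0 i)) * (c'.1 * (phi c'.2 * c'.2 ord0 i)) *
     dot c.2 c'.2 ^+ j.
  rewrite [RHS]exchange_big; apply: eq_bigr => c _ /=.
  rewrite [RHS]exchange_big; apply: eq_bigr => c' _ /=.
  rewrite exprS {1}/dot mulr_suml mulr_sumr; apply: eq_bigr => i _.
  by ring.
by apply: sumr_ge0 => i _; exact: (IHj (fun x => phi x * x ord0 i)).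
Qed.

(** The Gaussian factors as phi(x) phi(y) exp(2 t x.y), and the exponential series has nonnegative
    coefficients, so [dot_exp_psd] applies to each term. *)
Lemma gauss_psd (t : R) l : 0 <= t ->
  0 <= ksqnorm (fun x y => expR (- (t * sqn (x - y)))) l.
Proof.
move=> t0; pose phi x := expR (- (t * sqn x)).
have -> : ksqnorm (fun x y => expR (- (t * sqn (x - y)))) l =
    \sum_(c <- l) \sum_(c' <- l)
      (c.1 * phi c.2) * (c'.1 * phi c'.2) * expR (2 * t * dot c.2 c'.2).
  rewrite /ksqnorm; apply: eq_bigr => c _; apply: eq_bigr => c' _.
  rewrite sqnB (_ : - (t * _) =
    - (t * sqn c.2) + - (t * sqn c'.2) + 2 * t * dot c.2 c'.2); last by ring.
  by rewrite !expRD /phi; ring.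
have cE : (fun n => \sum_(c <- l) \sum_(c' <- l) (c.1 * phi c.2) * (c'.1 * phi c'.2) *
      series (exp_coeff (2 * t * dot c.2 c'.2)) n) @ \oo -->
    \sum_(c <- l) \sum_(c' <- l)
      (c.1 * phi c.2) * (c'.1 * phi c'.2) * expR (2 * t * dot c.2 c'.2).
  apply: cvgr_sum => c _; apply: cvgr_sum => c' _; apply: cvgMr.
  exact: is_cvg_series_exp_coeff.
apply: (cvgr_to_ge cE); apply: nearW => n.
have -> : \sum_(c <- l) \sum_(c' <- l) (c.1 * phi c.2) * (c'.1 * phi c'.2) *
      series (exp_coeff (2 * t * dot c.2 c'.2)) n =
   \sum_(j < n) (2 * t) ^+ j / j`!%:R * \sum_(c <- l) \sum_(c' <- l)
      (c.1 * phi c.2) * (c'.1 * phi c'.2) * dot c.2 c'.2 ^+ j.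
  under [RHS]eq_bigr do rewrite mulr_sumr.
  rewrite [RHS]exchange_big; apply: eq_bigr => c _ /=.
  under [RHS]eq_bigr do rewrite mulr_sumr.
  rewrite [RHS]exchange_big; apply: eq_bigr => c' _ /=.
  rewrite seriesEord /= mulr_sumr; apply: eq_bigr => i _.
  by rewrite /exp_coeff /= exprMn; ring.
apply: sumr_ge0 => j _; rewrite mulr_ge0 ?dot_exp_psd//.
by rewrite divr_ge0 ?ler0n// exprn_ge0// mulr_ge0.
Qed.

(** A polynomial in (x, y) of total degree below 2 m is a sum of products in which one factor has
    degree below [m], and [l] kills that factor. The induction removes one squared distance at a
    time by expanding (x_i - y_i)^2. *)
Lemma annihilates_sqn (m j a b : nat) (p q : mpoly d R) l : annihilates m l ->
  (msize p <= a.+1)%N -> (msize q <= b.+1)%N -> (a + b + j.*2 < m.*2)%N ->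
  \sum_(c <- l) \sum_(c' <- l)
    c.1 * c'.1 * (pfun p c.2 * pfun q c'.2 * sqn (c.2 - c'.2) ^+ j) = 0.
Proof.
move=> lm; elim: j a b p q => [|j IHj] a b p q pa qb abm.
  have -> : \sum_(c <- l) \sum_(c' <- l)
      c.1 * c'.1 * (pfun p c.2 * pfun q c'.2 * sqn (c.2 - c'.2) ^+ 0) =
    fapply l (pfun p) * fapply l (pfun q).
    rewrite /fapply mulr_suml; apply: eq_bigr => c _.
    rewrite mulr_sumr; apply: eq_bigr => c' _.
    by rewrite expr0; ring.
  have [am|ma] := ltnP a m; first by rewrite (lm p) ?mul0r//; exact: leq_trans am.
  rewrite (lm q) ?mulr0//; apply: (leq_trans qb).
  by rewrite ltnNge; apply/negP => mb; move: abm; rewrite addn0 -addnn ltnNge leq_add.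
pose X (i : 'I_d) : mpoly d R := mpolyX R (mnm1 i).
have XE i x : pfun (X i) x = x ord0 i by exact: mevalXU.
have ME p1 p2 x : pfun (p1 * p2) x = pfun p1 x * pfun p2 x :> R by exact: mevalM.
have sX i (p1 : mpoly d R) e : (msize p1 <= e.+1)%N -> (msize (p1 * X i) <= e.+2)%N.
  have [->|p1_neq0 p1e] := eqVneq p1 0; first by rewrite mul0r msize0.
  rewrite msizeM ?msizeX ?mdeg1 ?addn2//.
  by rewrite -msize_poly_eq0 msizeX.
have -> : \sum_(c <- l) \sum_(c' <- l)
    c.1 * c'.1 * (pfun p c.2 * pfun q c'.2 * sqn (c.2 - c'.2) ^+ j.+1) =
  \sum_(i < d) \sum_(c <- l) \sum_(c' <- l) c.1 * c'.1 * (pfun p c.2 * pfun q c'.2 *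
     ((c.2 - c'.2) ord0 i ^+ 2 * sqn (c.2 - c'.2) ^+ j)).
  rewrite [RHS]exchange_big; apply: eq_bigr => c _ /=.
  rewrite [RHS]exchange_big; apply: eq_bigr => c' _ /=.
  move: (pfun p _ * pfun q _) => P.
  by rewrite exprS {1}/sqn mulr_suml !mulr_sumr.
apply: big1 => i _.
have -> : \sum_(c <- l) \sum_(c' <- l) c.1 * c'.1 * (pfun p c.2 * pfun q c'.2 *
     ((c.2 - c'.2) ord0 i ^+ 2 * sqn (c.2 - c'.2) ^+ j)) =
  \sum_(c <- l) \sum_(c' <- l) c.1 * c'.1 *
     (pfun (p * X i * X i) c.2 * pfun q c'.2 * sqn (c.2 - c'.2) ^+ j)
  - 2 * \sum_(c <- l) \sum_(c' <- l) c.1 * c'.1 *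
     (pfun (p * X i) c.2 * pfun (q * X i) c'.2 * sqn (c.2 - c'.2) ^+ j)
  + \sum_(c <- l) \sum_(c' <- l) c.1 * c'.1 *
     (pfun p c.2 * pfun (q * X i * X i) c'.2 * sqn (c.2 - c'.2) ^+ j).
  rewrite mulr_sumr -sumrB -big_split; apply: eq_bigr => c _ /=.
  rewrite mulr_sumr -sumrB -big_split; apply: eq_bigr => c' _ /=.
  by rewrite !ME !XE !mxE; ring.
have abm' : ((a + b + j.*2).+2 < m.*2)%N by move: abm; rewrite doubleS !addnS.
rewrite (IHj a.+2 b _ _ (sX _ _ _ (sX _ _ _ pa)) qb) ?addSn//.
rewrite (IHj a.+1 b.+1 _ _ (sX _ _ _ pa) (sX _ _ _ qb)) ?addSn ?addnS//.
rewrite (IHj a b.+2 _ _ pa (sX _ _ _ (sX _ _ _ qb))) ?addnS//.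
by rewrite mulr0 subr0 addr0.
Qed.

(** An instance of [powR_sum_ge0] on the squared distances, with [exp_rem n.+1] for psi and nu / 2,
    which lies between [n] and [n.+1], for sigma. *)
Lemma phs_psd (n : nat) (nu : R) l : 2 * n%:R < nu < 2 * n.+1%:R ->
  annihilates n.+1 l ->
  0 <= ksqnorm (fun x y => (-1) ^+ n.+1 * enorm (x - y) `^ nu) l.
Proof.
move=> /andP[n_lt lt_n] ann.
pose I : seq (R * R) := [seq ((-1) ^+ n.+1 * (c.1 * c'.1), sqn (c.2 - c'.2)) | c <- l, c' <- l].
have IE (g : R -> R) : \sum_(p <- I) p.1 * g p.2 =
    \sum_(c <- l) \sum_(c' <- l) c.1 * c'.1 * ((-1) ^+ n.+1 * g (sqn (c.2 - c'.2))).
  rewrite /I big_allpairs_dep; apply: eq_bigr => c _; apply: eq_bigr => c' _ /=.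
  by ring.
rewrite (_ : ksqnorm _ _ = \sum_(p <- I) p.1 * p.2 `^ (nu / 2)); last first.
  by rewrite (IE (fun u => u `^ (nu / 2))); apply: eq_bigr => c _; apply: eq_bigr => c' _; rewrite enorm_powR.
have nf_ge1 : (n.+1`!%:R^-1 : R) <= n`!%:R^-1.
  by rewrite lef_pV2 ?posrE ?ltr0n ?fact_gt0// ler_nat factS leq_pmull.
apply: (@powR_sum_ge0 _ (exp_rem n.+1) n n`!%:R^-1) => //.
- exact: exp_rem_homo.
- exact: exp_rem0.
- exact: exp_rem_gt0.
- move=> u u0; rewrite mulrC (le_trans (exp_rem_le _ u0))// ler_wpM2l// exprn_ge0//.
- by move=> u u0; rewrite mulrC exp_remS_le.
- by rewrite ltr_pdivlMr// mulrC n_lt ltr_pdivrMr// mulrC.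
- by move=> p /allpairsP[[c c'] [_ _ ->]]; exact: sqn_ge0.
(* With its sign, [exp_rem] is an exponential minus a polynomial of degree at most [n] in the
   squared distance. The first gives a Gaussian form, and the second is annihilated. *)
move=> t t0; rewrite (IE (fun u => exp_rem n.+1 (t * u))).
under eq_bigr do under eq_bigr do rewrite exp_remE mulrBr.
under eq_bigr do rewrite sumrB.
rewrite sumrB [X in _ - X](_ : _ = 0) ?subr0 ?gauss_psd 1?ltW//.
under eq_bigr do under eq_bigr do rewrite mulr_sumr.
under eq_bigr do rewrite exchange_big /=.
rewrite exchange_big /=; apply: big1 => j _.
have := @annihilates_sqn n.+1 j 0 0 1 1 l ann.
rewrite msize1 !add0n ltn_double ltn_ord => /(_ isT isT isT) e.
apply: (etrans _ (etrans (congr1 ( *%R ((- t) ^+ j / j`!%:R)) e) (mulr0 _))).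
rewrite [RHS]mulr_sumr; apply: eq_bigr => c _.
rewrite [RHS]mulr_sumr; apply: eq_bigr => c' _.
have -> y : pfun 1 y = 1 :> R by exact: meval1.
by rewrite -mulNr exprMn; ring.
Qed.

End ConditionalPositivity.

(** * Smooth functions and finite differences *)

Section Smoothness.
Context {R : realType} {d : nat}.
Implicit Types (F G : 'rV[R]_d -> R) (x y v : 'rV[R]_d) (L : seq 'rV[R]_d) (n : nat).

Definition dl L F : 'rV[R]_d -> R := foldr (fun v (G : 'rV[R]_d -> R) => 'D_v G) F L.

(** Smoothness is expressed through iterated directional derivatives in arbitrary directions, the
    only ones that [mpartial] and the Taylor expansions along segments involve. *)
Fixpoint Cn n F : Prop :=
  continuous F /\
  if n is n'.+1 then forall v, (forall x, derivable F x v) /\ Cn n' ('D_v F) else True.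

Lemma Cn_continuous n F : Cn n F -> continuous F.
Proof. by case: n => [|n] []. Qed.

Lemma Cn_derivable n F v x : Cn n.+1 F -> derivable F x v.
Proof. by move=> [_ /(_ v)[]]. Qed.

Lemma Cn_derive n F v : Cn n.+1 F -> Cn n ('D_v F).
Proof. by move=> [_ /(_ v)[]]. Qed.

Lemma CnS n F : Cn n.+1 F -> Cn n F.
Proof.
elim: n F => [|n IHn] F [cF dF]; first by split.
by split=> // v; have [dFv /IHn] := dF v.
Qed.

Lemma CnW m n F : (m <= n)%N -> Cn n F -> Cn m F.
Proof.
move=> /subnK <-; elim: (n - m)%N => // k IHk.
by rewrite addSn => /CnS.
Qed.

Lemma Cn_cst n (c : R) : Cn n (cst c).
Proof.
elim: n c => [|n IHn] c; split => //; try exact: cst_continuous.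
move=> v; split=> [x|]; first exact: derivable_cst.
rewrite (_ : 'D_v (cst c) = cst 0)//.
by apply/funext => x; rewrite derive_cst.
Qed.

Lemma Cn_add n F G : Cn n F -> Cn n G -> Cn n (F \+ G).
Proof.
elim: n F G => [|n IHn] F G [cF dF] [cG dG]; split => //.
- by move=> x; exact: cvgD (cF x) (cG x).
- by move=> x; exact: cvgD (cF x) (cG x).
move=> v; have [dFv CF] := dF v; have [dGv CG] := dG v.
split=> [x|]; first exact: derivableD.
rewrite (_ : 'D_v (F \+ G) = 'D_v F \+ 'D_v G); first exact: IHn.
by apply/funext => x; exact: (deriveD (dFv x) (dGv x)).
Qed.

Lemma Cn_mul n F G : Cn n F -> Cn n G -> Cn n (F \* G).
Proof.
have cM F' G' : continuous F' -> continuous G' -> continuous (F' \* G').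
  by move=> cF cG x; exact: cvgM (cF x) (cG x).
elim: n F G => [|n IHn] F G CF CG; split => //.
- exact: cM (Cn_continuous CF) (Cn_continuous CG).
- exact: cM (Cn_continuous CF) (Cn_continuous CG).
move=> v.
have dFv x : derivable F x v by exact: Cn_derivable CF.
have dGv x : derivable G x v by exact: Cn_derivable CG.
split=> [x|]; first exact: derivableM.
rewrite (_ : 'D_v (F \* G) = (F \* 'D_v G) \+ (G \* 'D_v F)).
  by apply: Cn_add; apply: IHn; [exact: CnS|exact: Cn_derive|exact: CnS|exact: Cn_derive].
by apply/funext => x; rewrite [LHS](deriveM (dFv x) (dGv x)).
Qed.

Lemma Cn_scale n (c : R) F : Cn n F -> Cn n (fun x => c * F x).
Proof. by move=> CF; apply: (Cn_mul (Cn_cst n c) CF). Qed.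

Lemma Cn_sum n (I : Type) (r : seq I) (P : pred I) (F : I -> 'rV[R]_d -> R) :
  (forall i, P i -> Cn n (F i)) -> Cn n (fun x => \sum_(i <- r | P i) F i x).
Proof.
move=> CF; elim: r => [|i r IHr].
  rewrite (_ : (fun _ => _) = cst 0); first exact: Cn_cst.
  by apply/funext => x; rewrite big_nil.
have [Pi|Pi] := boolP (P i); last first.
  rewrite (_ : (fun _ => _) = (fun x => \sum_(i <- r | P i) F i x))//.
  by apply/funext => x; rewrite big_cons (negbTE Pi).
rewrite (_ : (fun _ => _) = F i \+ (fun x => \sum_(i <- r | P i) F i x)).
  exact: Cn_add (CF _ Pi) IHr.
by apply/funext => x; rewrite big_cons Pi.
Qed.

Lemma is_derive_coord (i : 'I_d) x v : is_derive x v (fun y : 'rV[R]_d => y ord0 i) (v ord0 i).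
Proof.
have der : derivable (fun y : 'rV[R]_d => y ord0 i) x v.
  exact/diff_derivable/differentiable_coord.
apply: DeriveDef => //; apply/cvg_lim => //.
apply: (@cvg_trans _ ((fun _ : R => v ord0 i) @ (0:R)^')); last exact: cvg_cst.
apply: near_eq_cvg; near=> h.
rewrite /= !mxE addrK /GRing.scale /= mulKf//.
by near: h; exact: nbhs_dnbhs_neq.
Unshelve. all: by end_near. Qed.

Lemma Cn_coord n (i : 'I_d) : Cn n (fun x => x ord0 i).
Proof.
have cc : continuous (fun x : 'rV[R]_d => x ord0 i) by exact: coord_continuous.
case: n => [|n]; split => // v; split=> [x|]; first by have [] := is_derive_coord i x v.
rewrite (_ : 'D_v _ = cst (v ord0 i)); first exact: Cn_cst.
by apply/funext => x; have [_ ->] := is_derive_coord i x v.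
Qed.

Lemma Cn_pfun n (p : mpoly d R) : Cn n (pfun p).
Proof.
rewrite (_ : pfun p = fun x => \sum_(m <- msupp p) mcoeff m p * \prod_(i < d) x ord0 i ^+ m i).
  apply: Cn_sum => m _; apply: Cn_scale.
  elim: (index_enum _) => [|i r IHr].
    rewrite (_ : (fun _ => _) = cst 1); first exact: Cn_cst.
    by apply/funext => x; rewrite big_nil.
  rewrite (_ : (fun _ => _) = (fun x => x ord0 i ^+ m i) \* (fun x => \prod_(i <- r) x ord0 i ^+ m i)).
    apply: Cn_mul IHr; elim: (m i) => [|k IHk].
      rewrite (_ : (fun _ => _) = cst 1); first exact: Cn_cst.
      by apply/funext => x; rewrite expr0.
    rewrite (_ : (fun _ => _) = (fun x => x ord0 i) \* (fun x => x ord0 i ^+ k)).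
      exact: Cn_mul (Cn_coord n i) IHk.
    by apply/funext => x; rewrite exprS.
  by apply/funext => x; rewrite big_cons.
by apply/funext => x; rewrite /pfun mevalE.
Qed.

Lemma derive_shiftE F y v x : 'D_v (fun x => F (x - y)) x = 'D_v F (x - y).
Proof.
rewrite /derive; set g1 := fun h => h^-1 *: _; set g2 := fun h => h^-1 *: _.
by have -> : g1 = g2 by apply/funext => h; rewrite /g1 /g2 /= addrA.
Qed.

Lemma derivable_shift F y v x : derivable F (x - y) v -> derivable (fun x => F (x - y)) x v.
Proof.
rewrite /derivable; set g1 := fun h => h^-1 *: _; set g2 := fun h => h^-1 *: _.
by have -> : g1 = g2 by apply/funext => h; rewrite /g1 /g2 /= addrA.
Qed.

Lemma continuous_shift F y : continuous F -> continuous (fun x => F (x - y)).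
Proof.
move=> cF x.
apply: (@cvg_comp _ _ _ (fun x => x - y) F (nbhs x) (nbhs (x - y))); last exact: cF.
exact: cvgB (@cvg_id _ (nbhs x)) (cvg_cst y).
Qed.

Lemma Cn_shift n F y : Cn n F -> Cn n (fun x => F (x - y)).
Proof.
elim: n F => [|n IHn] F [cF dF]; split=> //; try exact: continuous_shift.
move=> v; have [dFv CF] := dF v; split=> [x|]; first exact: derivable_shift.
rewrite (_ : 'D_v _ = fun x => ('D_v F) (x - y)); first exact: (IHn ('D_v F)).
by apply/funext => x; rewrite derive_shiftE.
Qed.

Lemma Cn_dl n L F : Cn (size L + n) F -> Cn n (dl L F).
Proof.
elim: L n => // v L IHL n; rewrite [size _]/= addSnnS => CF.
by apply: Cn_derive; exact: IHL.
Qed.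

Lemma dl_continuous L F : Cn (size L) F -> continuous (dl L F).
Proof. by rewrite -[size L]addn0 => /Cn_dl/Cn_continuous. Qed.

Lemma dl_derivable v L F x : Cn (size L).+1 F -> derivable (dl L F) x v.
Proof. by rewrite -addn1 => /Cn_dl; exact: Cn_derivable. Qed.

Lemma dl_shift L F y : dl L (fun x => F (x - y)) = fun x => dl L F (x - y).
Proof.
elim: L => //= v L ->; apply/funext => x.
exact: derive_shiftE.
Qed.

Lemma dlD L F G : Cn (size L) F -> Cn (size L) G ->
  dl L (F \+ G) = dl L F \+ dl L G.
Proof.
elim: L => //= v L IHL CF CG; rewrite IHL; try exact: CnS.
by apply/funext => x; apply: deriveD; exact: dl_derivable.
Qed.

Lemma dlZ L (c : R) F : Cn (size L) F ->
  dl L (fun x => c * F x) = fun x => c * dl L F x.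
Proof.
elim: L => //= v L IHL CF; rewrite IHL; last exact: CnS.
by apply/funext => x; apply: deriveZ; exact: dl_derivable.
Qed.

Lemma dl_sum L (I : Type) (r : seq I) (P : pred I) (F : I -> 'rV[R]_d -> R) :
  (forall i, P i -> Cn (size L) (F i)) ->
  dl L (fun x => \sum_(i <- r | P i) F i x) = fun x => \sum_(i <- r | P i) dl L (F i) x.
Proof.
move=> CF; elim: r => [|i r IHr].
  apply/funext => x; rewrite big_nil (_ : (fun _ => _) = (fun x => 0 * cst 0 x)).
    by rewrite dlZ ?mul0r//; exact: Cn_cst.
  by apply/funext => y; rewrite big_nil mul0r.
have [Pi|Pi] := boolP (P i); last first.
  rewrite (_ : (fun x => \sum_(i <- i :: r | P i) F i x) = (fun x => \sum_(i <- r | P i) F i x)) ?IHr.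
    by apply/funext => x; rewrite big_cons (negbTE Pi).
  by apply/funext => x; rewrite big_cons (negbTE Pi).
rewrite (_ : (fun x => \sum_(i <- i :: r | P i) F i x) =
    F i \+ (fun x => \sum_(i <- r | P i) F i x)) ?dlD ?IHr//.
- by apply/funext => x; rewrite big_cons Pi.
- exact: CF.
- exact: Cn_sum.
by apply/funext => x; rewrite big_cons Pi.
Qed.

End Smoothness.

(** * Finite differences in several directions *)

Section Stencils.
Context {R : realType} {d : nat}.
Implicit Types (F G : 'rV[R]_d -> R) (x y v : 'rV[R]_d) (L : seq 'rV[R]_d).

Lemma is_derive_line F x v (s : R) : derivable F (x + s *: v) v ->
  is_derive s 1 (fun s => F (x + s *: v)) ('D_v F (x + s *: v)).
Proof.
have E : (fun h => h^-1 *: ((F \o shift (x + s *: v)) (h *: v) - F (x + s *: v))) =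
  (fun h => h^-1 *: (((fun s => F (x + s *: v)) \o shift s) (h *: (1 : R)) -
     F (x + s *: v))).
  by apply/funext => h /=; rewrite [h%:A]mulr1 scalerDl addrCA.
by rewrite /derivable E => dF; apply: DeriveDef => //; rewrite /derive E.
Qed.

Lemma MVT_line F x v (t : R) : 0 < t -> (forall y, derivable F y v) ->
  exists2 s, 0 <= s <= t & F (x + t *: v) - F x = t * 'D_v F (x + s *: v).
Proof.
move=> t0 dF.
have dl s := is_derive_line (dF (x + s *: v)).
have [|s /andP[s0 st]] := @MVT R (fun s => F (x + s *: v)) _ 0 t t0 (fun s _ => dl s).
  apply: continuous_subspaceT => s; apply/differentiable_continuous/derivable1_diffP.
  by have [] := dl s.
rewrite scale0r addr0 subr0 => e; exists s; first by rewrite !ltW.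
by rewrite e mulrC.
Qed.

(** Weights and offsets in the expanded product of the operators which send F to F(. + v) - F, for
    [v] in [L]. *)
Fixpoint stencil L : seq (R * 'rV[R]_d) :=
  if L is v :: L' then
    [seq (c.1, c.2 + v) | c <- stencil L'] ++ [seq (- c.1, c.2) | c <- stencil L']
  else [:: (1, 0)].

Definition difference L (t : R) F y : R := \sum_(c <- stencil L) c.1 * F (y + t *: c.2).

Lemma difference_cons v L t F y :
  difference (v :: L) t F y = difference L t (fun y => F (y + t *: v) - F y) y.
Proof.
rewrite /difference /= big_cat /= !big_map -big_split /=; apply: eq_bigr => c _ /=.
by rewrite mulrBr mulNr scalerDr addrA.
Qed.

(** The mean value theorem is used in one direction at a time: the difference along [v] is taken
    inside, and commutes with the derivatives along the remaining directions. *)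
Lemma difference_mvt L t F y : 0 < t -> Cn (size L) F ->
  exists2 h, `|h| <= t * \sum_(v <- L) `|v| &
    difference L t F y = t ^+ size L * dl L F (y + h).
Proof.
move=> t0; elim: L F => [|v L IHL] F CF.
  exists 0; first by rewrite normr0 big_nil mulr0.
  by rewrite /difference /= big_seq1 scaler0 expr0.
pose G y := F (y + t *: v) - F y.
have CF' : Cn (size L) F by exact: CnS.
have CG : Cn (size L) G.
  rewrite (_ : G = (fun y => F (y - (- (t *: v)))) \+ (fun y => -1 * F y)).
    by apply: Cn_add; [exact: Cn_shift|exact: Cn_scale].
  by apply/funext => z; rewrite /G /= opprK mulN1r.
have [h hL e] := IHL G CG.
have dG z : dl L G z = dl L F (z + t *: v) - dl L F z.
  rewrite (_ : G = (fun y => F (y - (- (t *: v)))) \+ (fun y => -1 * F y)).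
    rewrite dlD; [|exact: Cn_shift|exact: Cn_scale].
    by rewrite dlZ// dl_shift /= opprK mulN1r.
  by apply/funext => w; rewrite /G /= opprK mulN1r.
have [s /andP[s0 st]] := MVT_line (y + h) t0 (fun z => @dl_derivable _ _ v L F z CF).
rewrite -dG => e'.
exists (h + s *: v).
  rewrite big_cons mulrDr addrC (le_trans (ler_normD _ _))// lerD//.
  by rewrite normrZ ger0_norm// ler_wpM2r.
by rewrite difference_cons e e' addrA exprSr mulrA.
Qed.

Lemma cvg_difference L F y : Cn (size L) F ->
  (fun i => (harmonic i : R) ^- size L * difference L (harmonic i) F y) @ \oo --> dl L F y.
Proof.
move=> CF; apply/cvgrPdist_lt => e e0.
have cF : continuous_at y (dl L F) by exact: dl_continuous CF _.
have /cvgrPdist_lt/(_ _ e0)/nbhs_ballP[del /= del0 Hdel] := cF.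
pose M := \sum_(v <- L) `|v|.
have M0 : 0 <= M by apply: sumr_ge0.
have hM : (fun i => harmonic i * M) @ \oo --> (0 : R).
  by rewrite -[X in _ --> X](mul0r M); apply: cvgMl; exact: cvg_harmonic.
near=> i.
have t0 := @harmonic_gt0 R i.
have [h hL ->] := difference_mvt y t0 CF.
rewrite mulrA mulVf ?mul1r; last by rewrite expf_neq0// gt_eqF.
apply: Hdel; rewrite -ball_normE /= opprD addrA subrr sub0r normrN.
apply: (le_lt_trans hL); rewrite -[ltLHS]ger0_norm; last by rewrite mulr_ge0// ltW.
by near: i; apply: cvgr0_norm_lt.
Unshelve. all: by end_near. Qed.

End Stencils.

(** * Derivatives of powers of the norm *)

Section HomogeneousTerms.
Context {R : realType} {d : nat}.
Implicit Types (F G : 'rV[R]_d -> R) (x y v : 'rV[R]_d) (kappa : R) (I : seq 'I_d).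

(** A monomial, with [I] listing its variables with multiplicity, times the power of the norm that
    makes the product homogeneous of degree [kappa]. The span of these terms is stable under
    differentiation, the degree dropping by one. *)
Definition hterm kappa I x : R :=
  (\prod_(i <- I) x ord0 i) * sqn x `^ ((kappa - (size I)%:R) / 2).

Definition hspan kappa F : Prop :=
  exists s : seq (R * seq 'I_d), F = fun x => \sum_(c <- s) c.1 * hterm kappa c.2 x.

Lemma sqn_eq0 x : (sqn x == 0) = (x == 0).
Proof.
rewrite /sqn psumr_eq0 => [|i _]; last exact: sqr_ge0.
apply/allP/eqP => [x0|-> i _]; last by rewrite /= mxE expr0n /= eqxx.
apply/rowP => i; rewrite mxE; apply/eqP.
by have := x0 i (mem_index_enum i); rewrite /= sqrf_eq0.
Qed.

Lemma sqn_gt0 x : (0 < sqn x) = (x != 0).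
Proof. by rewrite lt0r sqn_eq0 sqn_ge0 andbT. Qed.

Lemma htermS kappa i I x : hterm kappa (i :: I) x = x ord0 i * hterm (kappa - 1) I x.
Proof.
rewrite /hterm big_cons mulrA; congr (_ * _ `^ (_ / 2)).
by rewrite /= -natr1; ring.
Qed.

Lemma sqr_coord_le x (i : 'I_d) : x ord0 i ^+ 2 <= sqn x.
Proof. by rewrite /sqn (bigD1 i)//= lerDl sumr_ge0// => j _; exact: sqr_ge0. Qed.

Lemma norm_coord_le x (i : 'I_d) : `|x ord0 i| <= sqn x `^ 2^-1.
Proof.
rewrite powR12_sqrt ?sqn_ge0// -sqrtr_sqr ler_wsqrtr//.
exact: sqr_coord_le.
Qed.

Lemma hterm0 kappa I : 0 < kappa -> hterm kappa I 0 = 0.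
Proof.
move=> k0; case: I => [|i I]; last by rewrite htermS mxE mul0r.
have -> : hterm kappa [::] 0 = (sqn (0 : 'rV[R]_d)) `^ (kappa / 2).
  by rewrite /hterm big_nil mul1r subr0.
have /eqP -> : sqn (0 : 'rV[R]_d) == 0 by rewrite sqn_eq0.
by rewrite powR0// mulf_neq0 ?invr_eq0 ?pnatr_eq0// gt_eqF.
Qed.

Lemma hterm_norm_le kappa I x : x != 0 -> `|hterm kappa I x| <= sqn x `^ (kappa / 2).
Proof.
move=> x0; have s0 : 0 < sqn x by rewrite sqn_gt0.
elim: I kappa => [|i I IHI] kappa.
  by rewrite /hterm big_nil mul1r subr0 ger0_norm// powR_ge0.
rewrite htermS normrM (le_trans (ler_pM _ _ (norm_coord_le x i) (IHI _)))//.
rewrite -powRD; last by rewrite (gt_eqF s0) implybT.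
by rewrite (_ : 2^-1 + _ = kappa / 2)//; field.
Qed.

Lemma is_derive_sqn x v : is_derive x v sqn (2 * dot x v).
Proof.
have E : sqn = \sum_(i < d) ((fun y : 'rV[R]_d => y ord0 i) * (fun y => y ord0 i)).
  by apply/funext => y; rewrite fct_sumE.
have dE (i : 'I_d) : is_derive x v ((fun y : 'rV[R]_d => y ord0 i) * (fun y => y ord0 i))
    (2 * (x ord0 i * v ord0 i)).
  have h := is_derive_coord i x v.
  by apply: is_derive_eq; rewrite /GRing.scale /=; ring.
rewrite E; apply: is_derive_eq.
by rewrite /dot mulr_sumr.
Qed.

Lemma is_derive_sqn_powR e x v : x != 0 ->
  is_derive x v (fun y => sqn y `^ e) (e * sqn x `^ (e - 1) * (2 * dot x v)).
Proof.
move=> x0.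
have s0 : 0 < sqn x by rewrite sqn_gt0.
have [ds dsE] := is_derive_sqn x v.
have line : is_derive (0 : R) 1 (fun h => sqn (h *: v + x)) (2 * dot x v).
  apply: DeriveDef; first exact: (proj1 (derivable1P _ _ _) ds).
  rewrite -dsE /derive; set g1 := fun h => h^-1 *: _; set g2 := fun h => h^-1 *: _.
  have -> // : g1 = g2.
  by apply/funext => h; rewrite /g1 /g2 /= addr0 scale0r add0r [_%:A]mulr1.
have pw : is_derive (sqn (0 *: v + x)) 1 (fun u => u `^ e) (e * sqn x `^ (e - 1)).
  rewrite scale0r add0r; apply: DeriveDef.
    by apply: derivable_powR; rewrite in_itv /= s0.
  by rewrite -derive1E powR_derive1// in_itv /= s0.
have comp : is_derive (0 : R) 1 ((fun u => u `^ e) \o (fun h => sqn (h *: v + x)))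
   (e * sqn x `^ (e - 1) * (2 * dot x v)).
  apply: DeriveDef.
    apply/derivable1_diffP; apply: differentiable_comp; apply/derivable1_diffP.
      by have [] := line.
    by have [] := pw.
  rewrite -derive1E derive1_comp; [|by have [] := line|by have [] := pw].
  by rewrite !derive1E; have [_ ->] := line; have [_ ->] := pw.
apply: DeriveDef; first by apply/derivable1P; have [] := comp.
have [_ <-] := comp.
rewrite /derive; set g1 := fun h => h^-1 *: _; set g2 := fun h => h^-1 *: _.
have -> // : g1 = g2.
by apply/funext => h; rewrite /g1 /g2 /= addr0 scale0r add0r [_%:A]mulr1.
Qed.

Lemma hterm_derive kappa I v : exists s : seq (R * seq 'I_d), forall x, x != 0 ->
  is_derive x v (hterm kappa I) (\sum_(c <- s) c.1 * hterm (kappa - 1) c.2 x).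
Proof.
elim: I kappa => [|i I IHI] kappa.
  exists [seq (kappa * v ord0 i, [:: i]) | i <- enum 'I_d] => x x0.
  rewrite (_ : hterm kappa [::] = fun y => sqn y `^ (kappa / 2)); last first.
    by apply/funext => y; rewrite /hterm big_nil mul1r subr0.
  have h := is_derive_sqn_powR (kappa / 2) v x0.
  apply: is_derive_eq; rewrite big_map big_enum /= /dot !mulr_sumr.
  apply: eq_bigr => i _; rewrite /hterm big_seq1.
  rewrite (_ : (kappa - 1 - (size [:: i])%:R) / 2 = kappa / 2 - 1); last by rewrite /=; field.
  by field.
have [s Hs] := IHI (kappa - 1).
exists ((v ord0 i, I) :: [seq (c.1, i :: c.2) | c <- s]) => x x0.
rewrite (_ : hterm kappa (i :: I) =
    (fun y => y ord0 i) * hterm (kappa - 1) I); last first.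
  by apply/funext => y; rewrite htermS.
have h1 := Hs x x0; have h2 := is_derive_coord i x v.
apply: is_derive_eq; rewrite big_cons big_map /GRing.scale /= addrC mulrC; congr (_ + _).
rewrite mulr_sumr; apply: eq_bigr => c _.
by rewrite htermS mulrCA.
Qed.

Lemma enorm_le_norm x : sqn x `^ 2^-1 <= d%:R * `|x|.
Proof.
have le1 (i : 'I_d) : `|x ord0 i| <= `|x|.
  by rewrite [leRHS]/Num.norm /= mx_normrE (bigmax_sup (ord0, i)).
rewrite powR12_sqrt ?sqn_ge0// -(@ger0_norm _ (d%:R * `|x|)) ?mulr_ge0//.
rewrite -sqrtr_sqr ler_wsqrtr// exprMn.
have -> : d%:R ^+ 2 * `|x| ^+ 2 = \sum_(i < d) (d%:R * `|x| ^+ 2) :> R.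
  by rewrite sumr_const card_ord -mulr_natl; ring.
apply: ler_sum => i _.
rewrite -real_normK ?num_real// (@le_trans _ _ (`|x| ^+ 2))//.
  by rewrite lerXn2r ?nnegrE.
rewrite ler_peMl ?exprn_ge0// ler1n.
by apply: leq_ltn_trans (ltn_ord i).
Qed.

Lemma hspan_norm_le kappa F : 0 < kappa -> hspan kappa F ->
  exists2 C, 0 <= C & forall x, `|F x| <= C * sqn x `^ (kappa / 2).
Proof.
move=> k0 [s ->]; exists (\sum_(c <- s) `|c.1|); first exact: sumr_ge0.
move=> x; rewrite (le_trans (ler_norm_sum _ _ _))// mulr_suml; apply: ler_sum => c _.
rewrite normrM ler_wpM2l//.
have [->|x0] := eqVneq x 0; first by rewrite hterm0// normr0 powR_ge0.
exact: hterm_norm_le.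
Qed.

Lemma hspan0 kappa F : 0 < kappa -> hspan kappa F -> F 0 = 0.
Proof. by move=> k0 [s ->]; rewrite big1// => c _; rewrite hterm0// mulr0. Qed.

(** Away from the origin the derivative is computed term by term. At the origin the bound |F(x)| <=
    C |x|^kappa with [kappa] > 1 makes the difference quotient tend to 0, and [G] vanishes there
    because its degree is still positive. *)
Lemma hspan_derive kappa F v : 1 < kappa -> hspan kappa F ->
  exists2 G, hspan (kappa - 1) G & forall x, is_derive x v F (G x).
Proof.
move=> k1 hF.
have k0 : 0 < kappa - 1 by rewrite subr_gt0.
have [C C0 HC] := hspan_norm_le (lt_trans ltr01 k1) hF.
have F0 := hspan0 (lt_trans ltr01 k1) hF.
have [G [t HG] dG] : exists2 G, hspan (kappa - 1) G & forall x, x != 0 -> is_derive x v F (G x).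
  have [s ->] := hF.
  elim: s => [|c s [G [t HG] dG]].
    exists (fun x => 0); first by exists [::]; apply/funext => x; rewrite big_nil.
    move=> x _; rewrite (_ : (fun _ => _) = cst 0); first exact: is_derive_cst.
    by apply/funext => y; rewrite big_nil.
  have [u Hu] := hterm_derive kappa c.2 v.
  exists (fun x => c.1 * (\sum_(c <- u) c.1 * hterm (kappa - 1) c.2 x) + G x).
    exists ([seq (c.1 * c'.1, c'.2) | c' <- u] ++ t).
    apply/funext => x; rewrite big_cat big_map HG mulr_sumr; congr (_ + _).
    by apply: eq_bigr => c' _; rewrite mulrA.
  move=> x x0; rewrite (_ : (fun _ => _) =
    c.1 \*: hterm kappa c.2 + (fun x => \sum_(c <- s) c.1 * hterm kappa c.2 x)).
    have h1 := Hu x x0; have h2 := dG x x0.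
    exact: is_derive_eq.
  by apply/funext => y; rewrite big_cons.
exists G; first by exists t.
move=> x; have [->|] := eqVneq x 0; last exact: dG.
have G0 : G 0 = 0 by apply: (hspan0 k0); exists t.
rewrite G0.
suff lim0 : (fun h => h^-1 *: ((F \o shift 0) (h *: v) - F 0)) @ (0:R)^' --> (0:R).
  by apply: DeriveDef; [apply/cvg_ex; exists 0; exact: lim0|exact: cvg_lim lim0].
pose M := C * (d%:R * `|v|) `^ kappa.
have bound (h : R) : h != 0 -> `|h^-1 *: ((F \o shift 0) (h *: v) - F 0)| <= M * `|h| `^ (kappa - 1).
  move=> h0; rewrite F0 subr0 /= addr0 normrZ normfV ler_pdivrMl ?normr_gt0//.
  rewrite mulrCA mulr_powRB1 ?(lt_trans _ k1)//.
  rewrite (le_trans (HC _))// /M -mulrA ler_wpM2l//.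
  rewrite (mulrC kappa) powRrM -powRM ?mulr_ge0//.
  apply: ge0_ler_powR; rewrite ?nnegrE ?powR_ge0 ?mulr_ge0 ?(ltW (lt_trans _ k1))//.
  by rewrite (le_trans (enorm_le_norm _))// normrZ mulrCA mulrC.
apply/cvgr0Pnorm_le => e e0.
have lim1 : (fun h : R => M * `|h| `^ (kappa - 1)) @ (0:R)^' --> (0:R).
  rewrite -[X in _ --> X](mulr0 M); apply: cvgMr.
  apply/cvgr0Pnorm_le => eps eps0.
  near=> h; rewrite ger0_norm ?powR_ge0//.
  have -> : eps = (eps `^ (kappa - 1)^-1) `^ (kappa - 1).
    by rewrite -powRrM mulVf ?gt_eqF// powRr1// ltW.
  apply: ge0_ler_powR; rewrite ?nnegrE ?powR_ge0// ?(ltW k0)//.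
  by near: h; apply: dnbhs0_le; exact: powR_gt0.
near=> h.
have h0 : h != 0 by near: h; exact: nbhs_dnbhs_neq.
apply: (le_trans (bound h h0)); apply: (le_trans (ler_norm _)).
by near: h; exact: cvgr0_norm_le.
Unshelve. all: by end_near. Qed.

Lemma hspan_continuous kappa F : 0 < kappa -> hspan kappa F -> continuous F.
Proof.
move=> k0 hF; have F0 := hspan0 k0 hF; have [C C0 HC] := hspan_norm_le k0 hF.
have [s FE] := hF.
move=> x; have [->|x0] := eqVneq x 0; last first.
  rewrite FE; apply: (@cvgr_sum _ _ (nbhs x)) => c _; apply: cvgMr.
  rewrite /hterm; apply: cvgM.
    elim: (c.2) => [|i I IHI].
      by under eq_fun do rewrite big_nil; rewrite big_nil; exact: cvg_cst.
    under eq_fun do rewrite big_cons; rewrite big_cons.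
    by apply: cvgM => //; exact: coord_continuous.
  apply: (@cvg_comp _ _ _ sqn (fun u => u `^ ((kappa - (size c.2)%:R) / 2)) (nbhs x) (nbhs (sqn x))).
    apply: (@cvgr_sum _ _ (nbhs x)) => i _.
    by apply: cvgM; exact: coord_continuous.
  have cp : {for sqn x, continuous (fun u => u `^ ((kappa - (size c.2)%:R) / 2))}.
    apply/differentiable_continuous/derivable1_diffP/derivable_powR.
    by rewrite in_itv /= andbT sqn_gt0.
  exact: cp.
suff : F y @[y --> (0 : 'rV[R]_d)] --> (0 : R) by rewrite /continuous_at F0.
apply/(@cvgr0Pnorm_le _ _ _ (nbhs (0 : 'rV[R]_d))) => e e0.
pose del := (e / (C + 1)) `^ kappa^-1 / (d%:R + 1).
have d1 : 0 < d%:R + 1 :> R by rewrite ltr_pwDr.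
have C1 : 0 < C + 1 by rewrite ltr_pwDr.
have del0 : 0 < del by rewrite divr_gt0// powR_gt0// divr_gt0.
near=> y.
apply: (le_trans (HC y)).
have : sqn y `^ (kappa / 2) <= e / (C + 1).
  rewrite mulrC powRrM.
  have -> : e / (C + 1) = ((e / (C + 1)) `^ kappa^-1) `^ kappa.
    by rewrite -powRrM mulVf ?gt_eqF// powRr1// divr_ge0 ?ltW.
  apply: ge0_ler_powR; rewrite ?nnegrE ?powR_ge0 ?(ltW k0)//.
  rewrite (le_trans (enorm_le_norm y))//.
  rewrite (@le_trans _ _ ((d%:R + 1) * `|y|)) ?ler_wpM2r ?lerDl//.
  have : `|y| <= del.
    by near: y; exact: (@nbhs0_le R 'rV[R]_d del del0).
  by rewrite ler_pdivlMr// mulrC.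
rewrite ler_pdivlMr// => le_e.
have : 0 <= sqn y `^ (kappa / 2) by exact: powR_ge0.
lra.
Unshelve. all: by end_near. Qed.

Lemma hspan_derive_fun kappa F v : 1 < kappa -> hspan kappa F -> hspan (kappa - 1) ('D_v F).
Proof.
move=> k1 /(hspan_derive v k1)[G hG dG].
rewrite (_ : 'D_v F = G)//; apply/funext => x.
by have [_ ->] := dG x.
Qed.

Lemma hspan_Cn n kappa F : n%:R < kappa -> hspan kappa F -> Cn n F.
Proof.
elim: n kappa F => [|n IHn] kappa F nk hF.
  by split => //; exact: hspan_continuous hF.
have k1 : 1 < kappa by rewrite (le_lt_trans _ nk)// ler1n.
split; first by apply: hspan_continuous hF; rewrite (lt_trans ltr01).
move=> v; have [G hG dG] := hspan_derive v k1 hF; split=> [x|]; first by have [] := dG x.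
apply: (IHn (kappa - 1)); first by rewrite ltrBrDr natr1.
exact: hspan_derive_fun.
Qed.

Lemma hspan_dl L kappa F : (size L)%:R < kappa -> hspan kappa F ->
  hspan (kappa - (size L)%:R) (dl L F).
Proof.
elim: L => [|v L IHL] Lk hF; first by rewrite subr0.
rewrite /= -natr1 opprD addrA; apply: hspan_derive_fun.
  by rewrite ltrBrDr addrC natr1.
by apply: IHL => //; rewrite (le_lt_trans _ Lk)// ler_nat.
Qed.

Lemma hspan_enorm (c kappa : R) : hspan kappa (fun x => c * enorm x `^ kappa).
Proof.
exists [:: (c, [::])]; apply/funext => x.
by rewrite big_seq1 /hterm big_nil mul1r subr0 enorm_powR.
Qed.

End HomogeneousTerms.

(** * Polynomial interpolation *)

Section Interpolation.
Context {R : realType} {d : nat}.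
Implicit Types (p q : mpoly d R) (x : 'rV[R]_d) (m : nat).

Lemma pfunB p q x : pfun (p - q) x = pfun p x - pfun q x.
Proof. exact: mevalB. Qed.

Lemma pfunZ (c : R) p x : pfun (c *: p) x = c * pfun p x.
Proof. exact: mevalZ. Qed.

Lemma pfun_sum (I : Type) (r : seq I) (P : pred I) (p : I -> mpoly d R) x :
  pfun (\sum_(i <- r | P i) p i) x = \sum_(i <- r | P i) pfun (p i) x.
Proof. exact: raddf_sum. Qed.

Lemma Pi_D m p q : Pi_ m p -> Pi_ m q -> Pi_ m (p + q).
Proof. by move=> pm qm; rewrite /Pi_ /= (leq_trans (mmeasureD_le _ _ _))// geq_max pm. Qed.

Lemma Pi_Z m (c : R) p : Pi_ m p -> Pi_ m (c *: p).
Proof. by move=> pm; rewrite /Pi_ /= (leq_trans (mmeasureZ_le _ _ _)). Qed.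

Lemma Pi_sum m (I : Type) (r : seq I) (P : pred I) (p : I -> mpoly d R) :
  (forall i, P i -> Pi_ m (p i)) -> Pi_ m (\sum_(i <- r | P i) p i).
Proof.
by move=> pm; apply: (big_ind (Pi_ m)) => //; [rewrite /Pi_ /= msize0|exact: Pi_D].
Qed.

Lemma Pi_sum_seq m (I : eqType) (r : seq I) (p : I -> mpoly d R) :
  (forall i, i \in r -> Pi_ m (p i)) -> Pi_ m (\sum_(i <- r) p i).
Proof. by move=> pm; rewrite big_seq; exact: Pi_sum. Qed.

Lemma Pi_B m p q : Pi_ m p -> Pi_ m q -> Pi_ m (p - q).
Proof. by move=> pm qm; rewrite -scaleN1r; apply: Pi_D => //; exact: Pi_Z. Qed.

Lemma Pi_W m m' p : (m <= m')%N -> Pi_ m p -> Pi_ m' p.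
Proof. by move=> mm' pm; exact: leq_trans mm'. Qed.

Lemma pfun_big (r : seq ('rV[R]_d * mpoly d R)) (f : 'rV[R]_d * mpoly d R -> R) x :
  pfun (\sum_(c <- r) f c *: c.2) x = \sum_(c <- r) f c * pfun c.2 x.
Proof. by rewrite pfun_sum; apply: eq_bigr => c _; rewrite pfunZ. Qed.

(** Nodes are found greedily. If the residual of [b] is not the zero function, a point where it is
    nonzero becomes a node, the normalised residual becomes the Lagrange function of that node, and
    the older Lagrange functions are corrected to vanish there. *)
Lemma interpolation_seq m (bs : seq (mpoly d R)) : (forall b, b \in bs -> Pi_ m b) ->
  exists2 s : seq ('rV[R]_d * mpoly d R), (forall c, c \in s -> Pi_ m c.2) &
    forall b, b \in bs -> forall x, pfun b x = \sum_(c <- s) pfun b c.1 * pfun c.2 x.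
Proof.
elim: bs => [|b bs IH] bsm; first by exists [::].
have [|s sm Hs] := IH; first by move=> b' b'bs; apply: bsm; rewrite inE b'bs orbT.
have bm : Pi_ m b by apply: bsm; rewrite inE eqxx.
pose b' := b - \sum_(c <- s) pfun b c.1 *: c.2.
have b'm : Pi_ m b'.
  by apply: Pi_B => //; apply: Pi_sum_seq => c cs; apply: Pi_Z; exact: sm.
have b'E x : pfun b' x = pfun b x - \sum_(c <- s) pfun b c.1 * pfun c.2 x.
  by rewrite /b' pfunB pfun_big.
have [b'0|/existsNP[xi b'xi]] := pselect (forall x, pfun b' x = 0).
  exists s => // c; rewrite inE => /predU1P[->|/Hs//] x.
  by apply/eqP; rewrite -subr_eq0 -b'E b'0.
pose ell := (pfun b' xi)^-1 *: b'.
have ellm : Pi_ m ell by exact: Pi_Z.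
have QE p x : \sum_(c <- (xi, ell) :: [seq (c.1, c.2 - pfun c.2 xi *: ell) | c <- s])
      pfun p c.1 * pfun c.2 x =
    \sum_(c <- s) pfun p c.1 * pfun c.2 x +
    (pfun p xi - \sum_(c <- s) pfun p c.1 * pfun c.2 xi) * pfun ell x.
  rewrite big_cons big_map /= mulrBl [(\sum_(c <- s) _) * _]mulr_suml addrCA -sumrB; congr (_ + _).
  by apply: eq_bigr => c _; rewrite pfunB pfunZ mulrBr mulrA.
exists ((xi, ell) :: [seq (c.1, c.2 - pfun c.2 xi *: ell) | c <- s]).
  move=> c; rewrite inE => /predU1P[->//|/mapP[c' c's ->]].
  by apply: Pi_B; [exact: sm|exact: Pi_Z].
move=> c; rewrite inE => /predU1P[->|cbs] x; rewrite QE.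
  rewrite -b'E pfunZ mulrA mulfV ?mul1r; last exact/eqP.
  by rewrite b'E addrC subrK.
by rewrite -(Hs _ cbs x) -(Hs _ cbs xi) subrr mul0r addr0.
Qed.

(** Fixed nodes on which any functional can be corrected, by point evaluations, into one that
    annihilates [Pi_ m]. *)
Lemma interpolation m : exists2 s : seq ('rV[R]_d * mpoly d R),
  (forall c, c \in s -> Pi_ m c.2) &
  forall p, Pi_ m p -> forall x, pfun p x = \sum_(c <- s) pfun p c.1 * pfun c.2 x.
Proof.
have [|s sm Hs] := @interpolation_seq m [seq mpolyX R (val u) | u <- index_enum (bmultinom d m : finType)].
  by move=> b /mapP[u _ ->]; rewrite /Pi_ /= msizeX bmdeg.
exists s => // p pm x.
have pE : p = \sum_(u : bmultinom d m) mcoeff u p *: mpolyX R (val u) by exact: mpolywE.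
rewrite {1}pE pfun_sum.
under [RHS]eq_bigr do rewrite {1}pE pfun_sum mulr_suml.
rewrite [RHS]exchange_big /=; apply: eq_bigr => u _.
rewrite pfunZ (Hs (mpolyX R (val u))); last first.
  by apply/mapP; exists u; rewrite ?mem_index_enum.
rewrite mulr_sumr.
by apply: eq_bigr => c _; rewrite pfunZ mulrA.
Qed.

End Interpolation.

(** * Functionals containing derivatives *)

Section PolyharmonicForm.
Context {R : realType} {d : nat}.
Variables (n : nat) (nu : R).
Hypothesis nu_bounds : 2 * n%:R < nu < 2 * n.+1%:R.
Implicit Types (F G : 'rV[R]_d -> R) (x y z v : 'rV[R]_d) (L : seq 'rV[R]_d).
Implicit Types (w l : @fsupp R d) (A : seq (R * seq 'rV[R]_d)) (p : mpoly d R).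

(* [phs nu] with its sign made explicit: [n.+1] is the ceiling of [nu / 2]. *)
Definition sphs x : R := (-1) ^+ n.+1 * enorm x `^ nu.
Definition sphs_kernel x y : R := sphs (x - y).
Local Notation K := sphs_kernel.

Lemma nu_gt0 : 0 < nu.
Proof. by case/andP: nu_bounds => h _; rewrite (le_lt_trans _ h)// mulr_ge0. Qed.

Lemma lt_n_nu : n%:R < nu.
Proof. by case/andP: nu_bounds => h _; rewrite (le_lt_trans _ h)// mulr2n mulrDl mul1r lerDl. Qed.

Lemma enormN x : enorm (- x) = enorm x.
Proof. by rewrite /enorm; congr Num.sqrt; apply: eq_bigr => i _; rewrite mxE sqrrN. Qed.

Lemma enormZ (t : R) x : 0 <= t -> enorm (t *: x) = t * enorm x.
Proof.
move=> t0; rewrite /enorm -{2}(ger0_norm t0) -sqrtr_sqr -sqrtrM ?sqr_ge0//.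
by congr Num.sqrt; rewrite mulr_sumr; apply: eq_bigr => i _; rewrite mxE exprMn.
Qed.

Lemma sphs_kernelC x y : K x y = K y x.
Proof. by rewrite /K /sphs -enormN opprB. Qed.

Lemma sphsZ (t : R) x : 0 <= t -> sphs (t *: x) = t `^ nu * sphs x.
Proof. by move=> t0; rewrite /sphs enormZ// powRM ?sqrtr_ge0// mulrCA. Qed.

Lemma Cn_sphs_kernel y : Cn n (K ^~ y).
Proof.
apply: (@Cn_shift _ _ n sphs); apply: (hspan_Cn lt_n_nu).
exact: hspan_enorm.
Qed.

Definition dapp z A F : R := \sum_(a <- A) a.1 * dl a.2 F z.

(** A functional with a differential part at [z], given by coefficients and lists of directions, and
    a part made of point evaluations. *)
Definition gapp z (g : seq (R * seq 'rV[R]_d) * @fsupp R d) F : R :=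
  dapp z g.1 F + fapply g.2 F.

(* The quadratic form of the kernel on functionals [gapp z g]; the terms with
   derivatives in both arguments are left out, since they involve derivatives
   of [sphs] at the origin of order less than [nu], which vanish. *)
Definition gform z g h : R :=
  \sum_(c <- h.2) c.1 * dapp z g.1 (K ^~ c.2) +
  \sum_(c <- g.2) c.1 * dapp z h.1 (K ^~ c.2) + kform K g.2 h.2.

(** The order bound keeps the total order of any pair of derivatives at most 2 n, hence below
    [nu]. *)
Definition gadm z g : Prop :=
  (forall a, a \in g.1 -> (size a.2 <= n)%N) /\
  (forall p, Pi_ n.+1 p -> gapp z g (pfun p) = 0).

Lemma fapply_cat l l' F : fapply (l ++ l') F = fapply l F + fapply l' F.
Proof. by rewrite /fapply big_cat. Qed.

Lemma kformE l l' : kform K l l' = \sum_(c <- l') c.1 * fapply l (K ^~ c.2).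
Proof.
rewrite /kform exchange_big; apply: eq_bigr => c _ /=.
by rewrite /fapply mulr_sumr; apply: eq_bigr => c' _; ring.
Qed.

Lemma kformC l l' : kform K l l' = kform K l' l.
Proof.
rewrite /kform exchange_big; apply: eq_bigr => c _; apply: eq_bigr => c' _.
by rewrite sphs_kernelC [c'.1 * _]mulrC.
Qed.

Lemma kform_catl l1 l2 l : kform K (l1 ++ l2) l = kform K l1 l + kform K l2 l.
Proof. by rewrite /kform big_cat. Qed.

Lemma kform_catr l l1 l2 : kform K l (l1 ++ l2) = kform K l l1 + kform K l l2.
Proof. by rewrite !(kformC l) kform_catl. Qed.

Definition fd_approx z A (t : R) : @fsupp R d :=
  flatten [seq [seq (a.1 * t ^- size a.2 * c.1, z + t *: c.2) | c <- stencil a.2] | a <- A].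

Lemma fapply_fd_approx z A t F :
  fapply (fd_approx z A t) F = \sum_(a <- A) a.1 * (t ^- size a.2 * difference a.2 t F z).
Proof.
rewrite /fapply /fd_approx big_flatten big_map; apply: eq_bigr => a _.
rewrite big_map /difference !mulr_sumr; apply: eq_bigr => c _ /=.
by rewrite !mulrA.
Qed.

Lemma cvg_fd_approx z A F : (forall a, a \in A -> (size a.2 <= n)%N) -> Cn n F ->
  (fun i => fapply (fd_approx z A (harmonic i)) F) @ \oo --> dapp z A F.
Proof.
move=> An CF; under eq_fun do rewrite fapply_fd_approx big_seq.
rewrite /dapp big_seq; apply: cvgr_sum => a aA; apply: cvgMr.
by apply: cvg_difference; apply: CnW CF; exact: An.
Qed.

Lemma cvg_harmonic_powR (e : R) : 0 < e -> (fun i => (harmonic i : R) `^ e) @ \oo --> (0 : R).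
Proof.
move=> e0; apply/cvgr0Pnorm_le => eps eps0; near=> i.
rewrite ger0_norm ?powR_ge0//.
have -> : eps = (eps `^ e^-1) `^ e by rewrite -powRrM mulVf ?gt_eqF// powRr1// ltW.
apply: ge0_ler_powR; rewrite ?nnegrE ?powR_ge0 ?(ltW e0) ?harmonic_ge0//.
rewrite -[leLHS]ger0_norm ?harmonic_ge0//.
near: i; apply: cvgr0_norm_le; last exact: powR_gt0.
exact: cvg_harmonic.
Unshelve. all: by end_near. Qed.

(** By homogeneity of the kernel, the pairing of two difference quotients at scale t is a constant
    times t raised to [nu] minus the sum of their orders, a positive exponent since 2 n < [nu]. *)
Lemma cvg_kform_fd_approx z A : (forall a, a \in A -> (size a.2 <= n)%N) ->
  (fun i => kform K (fd_approx z A (harmonic i)) (fd_approx z A (harmonic i))) @ \oo --> (0 : R).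
Proof.
move=> An.
pose c0 (a a' : R * seq 'rV[R]_d) : R := a'.1 * a.1 *
  \sum_(c' <- stencil a'.2) \sum_(c <- stencil a.2) c'.1 * c.1 * sphs (c.2 - c'.2).
have E i : kform K (fd_approx z A (harmonic i)) (fd_approx z A (harmonic i)) =
  \sum_(a' <- A | a' \in A) \sum_(a <- A | a \in A)
    c0 a a' * (harmonic i : R) `^ (nu - (size a'.2 + size a.2)%:R).
  have t0 : 0 < harmonic i :> R by exact: harmonic_gt0.
  set t := harmonic i in t0 *.
  rewrite kformE /fd_approx big_flatten big_map big_seq; apply: eq_bigr => a' a'A.
  rewrite big_map.
  under eq_bigr do rewrite fapply_fd_approx big_seq mulr_sumr.
  rewrite exchange_big /=; apply: eq_bigr => a aA.
  rewrite /c0 powRB ?(gt_eqF t0) ?implybT// powR_mulrn ?ltW// exprD.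
  rewrite mulr_sumr mulr_suml; apply: eq_bigr => c' _.
  rewrite /difference !mulr_sumr mulr_suml; apply: eq_bigr => c _.
  rewrite /K opprD addrACA subrr add0r -scalerBr sphsZ ?ltW//.
  by rewrite invfM; ring.
under eq_fun do rewrite E.
have S0 : \sum_(a' <- A | a' \in A) \sum_(a <- A | a \in A) c0 a a' * 0 = 0.
  by rewrite big1// => a' _; rewrite big1// => a _; rewrite mulr0.
have lim : (fun i => \sum_(a' <- A | a' \in A) \sum_(a <- A | a \in A)
    c0 a a' * (harmonic i : R) `^ (nu - (size a'.2 + size a.2)%:R)) @ \oo -->
  \sum_(a' <- A | a' \in A) \sum_(a <- A | a \in A) c0 a a' * 0.
  apply: cvgr_sum => a' /An a'n; apply: cvgr_sum => a /An an; apply: cvgMr.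
  apply: cvg_harmonic_powR; rewrite subr_gt0 (le_lt_trans _ (andP nu_bounds).1)//.
  by rewrite -natrM ler_nat mul2n -addnn leq_add.
by move: lim; rewrite S0.
Qed.

(** The form is a limit of values of [ksqnorm] on point functionals to which [phs_psd] applies. *)
Lemma gform_psd z g : gadm z g -> 0 <= gform z g g.
Proof.
move=> [gn g0].
have [s sm Hs] := @interpolation R d n.+1.
pose l i := fd_approx z g.1 (harmonic i) ++ g.2.
(* These weights at the interpolation nodes cancel [l i] on polynomials. They tend to 0 because [g]
   itself annihilates polynomials. *)
pose corr i : @fsupp R d := [seq (- fapply (l i) (pfun c.2), c.1) | c <- s].
have ann i : annihilates n.+1 (l i ++ corr i).
  move=> p pm; rewrite fapply_cat {2}/fapply big_map /=.
  under [X in _ + X]eq_bigr do rewrite mulNr.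
  rewrite sumrN; apply/eqP; rewrite subr_eq0; apply/eqP.
  rewrite {1}/fapply; under eq_bigr do rewrite (Hs _ pm) mulr_sumr.
  rewrite exchange_big /=; apply: eq_bigr => c _.
  rewrite /fapply mulr_suml; apply: eq_bigr => c' _.
  by ring.
have cl F : Cn n F -> (fun i => fapply (l i) F) @ \oo --> gapp z g F.
  move=> CF; under eq_fun do rewrite fapply_cat.
  by apply: cvgD; [exact: cvg_fd_approx|exact: cvg_cst].
have cp c : c \in s -> (fun i => fapply (l i) (pfun c.2)) @ \oo --> (0 : R).
  by move=> cs; rewrite -(g0 c.2 (sm _ cs)); apply: cl; exact: Cn_pfun.
(* The first summand tends to 0 by [cvg_kform_fd_approx], and each summand stemming from [corr]
   contains a factor that tends to 0; what survives is [gform]. *)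
have E i : ksqnorm K (l i ++ corr i) =
    kform K (fd_approx z g.1 (harmonic i)) (fd_approx z g.1 (harmonic i)) +
    2 * (\sum_(c <- g.2) c.1 * fapply (fd_approx z g.1 (harmonic i)) (K ^~ c.2)) +
    kform K g.2 g.2 +
    2 * (\sum_(c <- s | c \in s) - fapply (l i) (pfun c.2) * fapply (l i) (K ^~ c.1)) +
    \sum_(c <- s | c \in s) \sum_(c' <- s | c' \in s)
      fapply (l i) (pfun c.2) * (fapply (l i) (pfun c'.2) * K c.1 c'.1).
  rewrite -[ksqnorm _ _]/(kform K (l i ++ corr i) (l i ++ corr i)).
  rewrite (kform_catl (l i) (corr i)) !(kform_catr _ (l i) (corr i)) (kformC (corr i) (l i)).
  have -> : kform K (l i) (l i) =
      kform K (fd_approx z g.1 (harmonic i)) (fd_approx z g.1 (harmonic i)) +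
      2 * kform K (fd_approx z g.1 (harmonic i)) g.2 + kform K g.2 g.2.
    by rewrite kform_catl !kform_catr (kformC g.2 (fd_approx _ _ _)); ring.
  have -> : kform K (l i) (corr i) =
      \sum_(c <- s | c \in s) - fapply (l i) (pfun c.2) * fapply (l i) (K ^~ c.1).
    by rewrite kformE big_map big_seq.
  have -> : kform K (corr i) (corr i) = \sum_(c <- s | c \in s) \sum_(c' <- s | c' \in s)
      fapply (l i) (pfun c.2) * (fapply (l i) (pfun c'.2) * K c.1 c'.1).
    rewrite /kform big_map big_seq; apply: eq_bigr => c _.
    by rewrite big_map big_seq; apply: eq_bigr => c' _ /=; rewrite mulrNN mulrA.
  rewrite [kform K (fd_approx _ _ _) g.2]kformE.
  ring.
have lim : (fun i => ksqnorm K (l i ++ corr i)) @ \oo --> gform z g g.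
  under eq_fun do rewrite E.
  rewrite (_ : gform z g g = 0 + 2 * (\sum_(c <- g.2) c.1 * dapp z g.1 (K ^~ c.2)) +
    kform K g.2 g.2 + 2 * (\sum_(c <- s | c \in s) - 0 * gapp z g (K ^~ c.1)) +
    \sum_(c <- s | c \in s) \sum_(c' <- s | c' \in s) 0 * (0 * K c.1 c'.1)); last first.
    have -> : \sum_(c <- s | c \in s) - 0 * gapp z g (K ^~ c.1) = 0.
      by rewrite big1// => c _; rewrite oppr0 mul0r.
    have -> : \sum_(c <- s | c \in s) \sum_(c' <- s | c' \in s) 0 * (0 * K c.1 c'.1) = 0.
      by rewrite big1// => c _; rewrite big1// => c' _; rewrite mul0r.
    by rewrite /gform; ring.
  apply: cvgD; last first.
    apply: cvgr_sum => c cs; apply: cvgr_sum => c' c's.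
    by apply: cvgM; [exact: cp|apply: cvgMl; exact: cp].
  apply: cvgD; last first.
    apply: cvgMr; apply: cvgr_sum => c cs; apply: cvgM; first by apply: cvgN; exact: cp.
    by apply: cl; exact: Cn_sphs_kernel.
  apply: cvgD; last exact: cvg_cst.
  apply: cvgD; first exact: cvg_kform_fd_approx.
  apply: cvgMr; apply: cvgr_sum => c _; apply: cvgMr.
  by apply: cvg_fd_approx => //; exact: Cn_sphs_kernel.
apply: (cvgr_to_ge lim); apply: nearW => i.
exact: (phs_psd nu_bounds (ann i)).
Qed.

Definition gcomb (t : R) (g h : seq (R * seq 'rV[R]_d) * @fsupp R d) :=
  (g.1 ++ [seq (t * a.1, a.2) | a <- h.1], g.2 ++ [seq (t * c.1, c.2) | c <- h.2]).

Lemma dapp_comb z t A A' F :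
  dapp z (A ++ [seq (t * a.1, a.2) | a <- A']) F = dapp z A F + t * dapp z A' F.
Proof.
rewrite /dapp big_cat big_map mulr_sumr; congr (_ + _).
by apply: eq_bigr => a _; rewrite mulrA.
Qed.

Lemma sum_comb t w w' (f : 'rV[R]_d -> R) :
  \sum_(c <- w ++ [seq (t * c.1, c.2) | c <- w']) c.1 * f c.2 =
  \sum_(c <- w) c.1 * f c.2 + t * \sum_(c <- w') c.1 * f c.2.
Proof.
rewrite big_cat big_map mulr_sumr; congr (_ + _).
by apply: eq_bigr => a _; rewrite mulrA.
Qed.

Lemma gapp_comb z t g h F : gapp z (gcomb t g h) F = gapp z g F + t * gapp z h F.
Proof. by rewrite /gapp /= dapp_comb /fapply sum_comb; ring. Qed.

Lemma gadm_comb z t g h : gadm z g -> gadm z h -> gadm z (gcomb t g h).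
Proof.
move=> [gn g0] [hn h0]; split=> [a|p pm]; last first.
  by rewrite gapp_comb g0// h0// mulr0 addr0.
by rewrite mem_cat => /orP[/gn//|/mapP[a' /hn ? ->]].
Qed.

Lemma gformC z g h : gform z g h = gform z h g.
Proof. by rewrite /gform kformC [X in X + _]addrC. Qed.

Lemma gform_comb z t g h k : gform z (gcomb t g h) k = gform z g k + t * gform z h k.
Proof.
rewrite /gform /=.
under eq_bigr do rewrite dapp_comb mulrDr mulrCA.
rewrite big_split /= -mulr_sumr (sum_comb _ _ _ (fun y => dapp z k.1 (K ^~ y))).
rewrite (kformC (_ ++ _)) !(kformC _ k.2) !kformE.
rewrite (sum_comb _ _ _ (fun y => fapply k.2 (K ^~ y))).
ring.
Qed.

Lemma gform_CS z g h : gadm z g -> gadm z h ->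
  gform z g h ^+ 2 <= gform z g g * gform z h h.
Proof.
move=> ga ha.
have quad t : 0 <= gform z g g + 2 * t * gform z g h + t ^+ 2 * gform z h h.
  have := gform_psd (gadm_comb t ga ha).
  rewrite gform_comb gformC gform_comb [gform z h (gcomb _ _ _)]gformC gform_comb.
  by rewrite (gformC z h g) => /le_trans; apply; rewrite le_eqVlt; apply/orP; left; apply/eqP; ring.
have h0 : 0 <= gform z h h by exact: gform_psd.
set a := gform z g g in quad *; set b := gform z g h in quad *; set c := gform z h h in quad h0 *.
have [c0|c_neq0] := eqVneq c 0.
  (* The quadratic degenerates to an affine function of [t], which at this argument would equal -1
     if [b] were nonzero. *)
  rewrite c0 mulr0 in quad *; have := quad (- (a + 1) / (2 * b)).
  have [-> _|b0] := eqVneq b 0; first by rewrite expr0n.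
  by rewrite mulr0 addr0 (_ : 2 * _ * b = - (a + 1)); [lra|field].
have cpos : 0 < c by rewrite lt0r c_neq0.
(* The minimum of the quadratic. *)
have := quad (- b / c).
rewrite (_ : a + _ + _ = (a * c - b ^+ 2) / c); last by field.
by rewrite pmulr_lge0 ?invr_gt0// subr_ge0.
Qed.

End PolyharmonicForm.

(** * Native functions *)

Section UniformDerivatives.
Context {R : realType} {d : nat}.
Implicit Types (f : 'rV[R]_d -> R) (F : nat -> 'rV[R]_d -> R) (x y v : 'rV[R]_d).

Lemma cauchy_seq_cvg (u : R^nat) :
  (forall e, 0 < e -> exists n0, forall m n, (n0 <= m)%N -> (n0 <= n)%N ->
    `|u m - u n| <= e) -> cvgn u.
Proof.
move=> H; apply: cauchy_cvg; apply/cauchy_ballP => e e0.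
have [|n0 Hn0] := H (e / 2); first by rewrite divr_gt0.
have nF : (u @ \oo) (u @` [set m | (n0 <= m)%N]).
  by apply: filterS (nbhs_infty_ge n0) => m nm; exists m.
exists (u @` [set m | (n0 <= m)%N], u @` [set m | (n0 <= m)%N]) => //=.
move=> [_ _] /= [[a na <-] [b nb <-]]; rewrite /ball /=.
apply: (le_lt_trans (Hn0 _ _ na nb)).
by rewrite ltr_pdivrMr// ltr_pMr// ltr1n.
Qed.

Lemma MVT_line_norm f y v (t : R) : t != 0 -> (forall x, derivable f x v) ->
  exists2 s, `|s| <= `|t| & f (y + t *: v) - f y = t * 'D_v f (y + s *: v).
Proof.
move=> t0 df; have [tpos|tneg|te] := ltgtP 0 t; last by rewrite -te eqxx in t0.
  have [s /andP[s0 st] e] := MVT_line y tpos df.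
  by exists s => //; rewrite !ger0_norm// (le_trans s0).
have nt : 0 < - t by rewrite oppr_gt0.
have [s /andP[s0 st] e] := MVT_line (y + t *: v) nt df.
have ts : t + s <= 0 by lra.
exists (t + s); first by rewrite (ler0_norm ts) (ltr0_norm tneg); lra.
rewrite scalerDl addrA -opprB.
have -> : f y = f (y + t *: v + - t *: v) by rewrite scaleNr addrK.
by rewrite e mulNr opprK.
Qed.

(** Near [y] the derivative of [F n0 - F b] is small uniformly in [b], so by the mean value theorem
    its difference quotients are small; letting [b] tend to infinity compares the quotients of [f]
    with those of [F n0]. *)
Lemma cvg_derive_uniform F f v y :
  (forall i x, derivable (F i) x v) -> (forall x, (fun i => F i x) @ \oo --> f x) ->
  (forall e, 0 < e -> exists n0, \forall x \near y, forall a b, (n0 <= a)%N -> (n0 <= b)%N ->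
    `|'D_v (F a) x - 'D_v (F b) x| <= e) ->
  (fun i => 'D_v (F i) y) @ \oo --> 'D_v f y.
Proof.
move=> dF cF cauchy.
have cD : cvgn (fun i => 'D_v (F i) y).
  apply: cauchy_seq_cvg => e /cauchy[n0 /nbhs_singleton Hn0].
  by exists n0 => a b; exact: Hn0.
set ell := limn (fun i => 'D_v (F i) y).
have cell : (fun i => 'D_v (F i) y) @ \oo --> ell by exact: cD.
suff -> : 'D_v f y = ell by [].
apply: cvg_lim => //; apply/cvgrPdist_le => e e0.
have e3 : 0 < e / 3 by rewrite divr_gt0.
have [n0 /nbhs_ballP[del /= del0 Hdel]] := cauchy _ e3.
have Dell : `|'D_v (F n0) y - ell| <= e / 3.
  have c1 : (fun b => `|'D_v (F n0) y - 'D_v (F b) y|) @ \oo --> `|'D_v (F n0) y - ell|.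
    by apply: cvg_norm; apply: cvgB => //; exact: cvg_cst.
  apply: (cvgr_to_le c1); near=> b.
  apply: Hdel => //; first exact: ballxx.
  by near: b; exact: nbhs_infty_ge.
have quot : (fun h => h^-1 *: ((F n0 \o shift y) (h *: v) - F n0 y)) @ (0:R)^' --> 'D_v (F n0) y.
  exact: dF.
have v1 : 0 < `|v| + 1 by rewrite ltr_pwDr.
have dv : 0 < del / (`|v| + 1) by rewrite divr_gt0.
near=> h.
have h0 : h != 0 by near: h; exact: nbhs_dnbhs_neq.
have hq : `|'D_v (F n0) y - h^-1 *: ((F n0 \o shift y) (h *: v) - F n0 y)| <= e / 3.
  by near: h; move/cvgrPdist_le : quot; exact.
have hdel : `|h| < del / (`|v| + 1) by near: h; exact: dnbhs0_lt.
have diff : `|(F n0 (h *: v + y) - f (h *: v + y)) - (F n0 y - f y)| <= `|h| * (e / 3).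
  have c1 : (fun b => `|(F n0 (h *: v + y) - F b (h *: v + y)) - (F n0 y - F b y)|) @ \oo -->
      `|(F n0 (h *: v + y) - f (h *: v + y)) - (F n0 y - f y)|.
    by apply: cvg_norm; apply: cvgB; apply: cvgB => //; exact: cvg_cst.
  apply: (cvgr_to_le c1); near=> b.
  have nb : (n0 <= b)%N by near: b; exact: nbhs_infty_ge.
  pose G x := F n0 x - F b x.
  have dG x : derivable G x v by exact: (derivableB (dF n0 x) (dF b x)).
  have [s sh] := @MVT_line_norm G y v h h0 dG.
  rewrite [y + h *: v]addrC /G => ->; rewrite normrM ler_wpM2l//.
  have -> : 'D_v (fun x => F n0 x - F b x) (y + s *: v) =
      'D_v (F n0) (y + s *: v) - 'D_v (F b) (y + s *: v).
    exact: (deriveB (dF n0 _) (dF b _)).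
  apply: Hdel => //; rewrite -ball_normE /= opprD addrA subrr sub0r normrN normrZ.
  apply: (@le_lt_trans _ _ (`|h| * (`|v| + 1))); last by rewrite -ltr_pdivlMr.
  by apply: ler_pM => //; rewrite lerDl.
have q2 : `|h^-1 *: ((F n0 \o shift y) (h *: v) - F n0 y) - h^-1 *: ((f \o shift y) (h *: v) - f y)| <= e / 3.
  rewrite -scalerBr normrZ normfV ler_pdivrMl ?normr_gt0//.
  by rewrite (le_trans _ diff)// le_eqVlt /=; apply/orP; left; apply/eqP; congr `|_|; ring.
move: Dell hq q2.
set A := 'D_v (F n0) y; set B := _ *: (_ - F n0 y); set C := _ *: (_ - f y).
move=> Dell hq q2.
have -> : ell - C = - (A - ell) + (A - B) + (B - C) by ring.
rewrite (le_trans (ler_normD _ _))// (_ : e = e / 3 + e / 3 + e / 3); last by field.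
rewrite lerD// (le_trans (ler_normD _ _))// lerD// normrN//.
Unshelve. all: by end_near. Qed.

Lemma cvg_dl F f n :
  (forall i, Cn n (F i)) -> (forall x, (fun i => F i x) @ \oo --> f x) ->
  (forall L, (size L <= n)%N -> forall y e, 0 < e -> exists n0, \forall x \near y,
     forall a b, (n0 <= a)%N -> (n0 <= b)%N -> `|dl L (F a) x - dl L (F b) x| <= e) ->
  forall L, (size L <= n)%N -> forall y, (fun i => dl L (F i) y) @ \oo --> dl L f y.
Proof.
move=> CF cF cauchy; elim=> [_|v L IHL Ln] y; first exact: cF.
apply: (@cvg_derive_uniform (fun i => dl L (F i))).
- by move=> i x; apply: dl_derivable; exact: CnW (CF i).
- by apply: IHL; exact: ltnW.
- exact: (cauchy (v :: L)).
Qed.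

End UniformDerivatives.

(** * Approximating sequences of native functions *)

Section NativeSpace.
Context {R : realType} {d : nat}.
Variables (n : nat) (nu : R).
Hypothesis nu_bounds : 2 * n%:R < nu < 2 * n.+1%:R.
Implicit Types (F G : 'rV[R]_d -> R) (x y z v : 'rV[R]_d) (L : seq 'rV[R]_d).
Implicit Types (l : @fsupp R d).
Local Notation K := (@sphs_kernel R d n nu).

Lemma Cn_ksum l : Cn n (ksum K l).
Proof. by apply: Cn_sum => c _; apply: Cn_scale; exact: Cn_sphs_kernel. Qed.

Lemma dl_ksum L l z : (size L <= n)%N ->
  dl L (ksum K l) z = \sum_(c <- l) c.1 * dl L (K ^~ c.2) z.
Proof.
move=> Ln; have CK c : Cn (size L) (K ^~ c).
  by apply: CnW Ln _; exact: Cn_sphs_kernel.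
rewrite /ksum dl_sum => [|c _]; last by apply: Cn_scale.
by apply: eq_bigr => c _; rewrite dlZ.
Qed.

Lemma gapp_ksum z g l : (forall a, a \in g.1 -> (size a.2 <= n)%N) ->
  gapp z g (ksum K l) = gform n nu z g ([::], l).
Proof.
move=> gn; rewrite /gapp /gform /=.
rewrite [X in _ = _ + X + _]big1 ?addr0 => [|c _]; last by rewrite /dapp big_nil mulr0.
congr (_ + _).
  rewrite /dapp; under [RHS]eq_bigr do rewrite mulr_sumr.
  rewrite [RHS]exchange_big /= big_seq [RHS]big_seq; apply: eq_bigr => a aA.
  rewrite dl_ksum; last exact: gn.
  by rewrite mulr_sumr; apply: eq_bigr => c _; rewrite mulrCA.
rewrite /fapply /kform; apply: eq_bigr => c _.
by rewrite /ksum mulr_sumr; apply: eq_bigr => c' _; rewrite mulrA.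
Qed.

Lemma gform_kform z l l' : gform n nu z ([::], l) ([::], l') = kform K l l'.
Proof.
rewrite /gform /= [X in X + _ + _]big1 ?[X in _ + X + _]big1 ?add0r// => c _.
  by rewrite /dapp big_nil mulr0.
by rewrite /dapp big_nil mulr0.
Qed.

Lemma gform_ksqnorm z l : gform n nu z ([::], l) ([::], l) = ksqnorm K l.
Proof. exact: gform_kform. Qed.

Lemma kform_fsubl l l' h : kform K (fsub l l') h = kform K l h - kform K l' h.
Proof.
rewrite /kform /fsub big_cat big_map -sumrN; congr (_ + _).
apply: eq_bigr => c _; rewrite -sumrN; apply: eq_bigr => c' _ /=.
by rewrite !mulNr.
Qed.

Lemma gadm_annihilates z l : annihilates n.+1 l -> gadm n z ([::], l).
Proof. by move=> ann; split=> // p /ann; rewrite /gapp /dapp big_nil add0r. Qed.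

Lemma gapp_ksum_le z g l : gadm n z g -> annihilates n.+1 l ->
  `|gapp z g (ksum K l)| <= Num.sqrt (gform n nu z g g) * Num.sqrt (ksqnorm K l).
Proof.
move=> ga ann; have gl := gadm_annihilates z ann.
rewrite gapp_ksum; last exact: ga.1.
rewrite -sqrtrM; last exact: gform_psd.
rewrite -sqrtr_sqr ler_wsqrtr// -(gform_ksqnorm z).
exact: gform_CS.
Qed.

Lemma gappD z g F G : (forall a, a \in g.1 -> (size a.2 <= n)%N) -> Cn n F -> Cn n G ->
  gapp z g (F \+ G) = gapp z g F + gapp z g G.
Proof.
move=> gn CF CG; rewrite /gapp /dapp addrACA; congr (_ + _).
  rewrite big_seq [X in _ = X + _]big_seq [X in _ = _ + X]big_seq -big_split.
  apply: eq_bigr => a /gn an; rewrite dlD; [|exact: CnW an CF|exact: CnW an CG].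
  by rewrite /= mulrDr.
by rewrite /fapply -big_split; apply: eq_bigr => c _; rewrite /= mulrDr.
Qed.

Lemma gappZ z g (c : R) F : (forall a, a \in g.1 -> (size a.2 <= n)%N) -> Cn n F ->
  gapp z g (fun x => c * F x) = c * gapp z g F.
Proof.
move=> gn CF; rewrite /gapp /dapp mulrDr; congr (_ + _).
  rewrite big_seq [X in _ = _ * X]big_seq mulr_sumr.
  apply: eq_bigr => a /gn an; rewrite dlZ; last exact: CnW an CF.
  by rewrite mulrCA.
by rewrite /fapply mulr_sumr; apply: eq_bigr => x _; rewrite mulrCA.
Qed.

Lemma fapply_fsub l l' F : fapply (fsub l l') F = fapply l F - fapply l' F.
Proof.
rewrite /fapply /fsub big_cat big_map -sumrN; congr (_ + _).
by apply: eq_bigr => c _; rewrite mulNr.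
Qed.

Lemma annihilates_fsub m l l' : annihilates m l -> annihilates m l' -> annihilates m (fsub l l').
Proof. by move=> al al' p pm; rewrite fapply_fsub al// al'// subrr. Qed.

Lemma annihilatesW m m' l : (m <= m')%N -> annihilates m' l -> annihilates m l.
Proof. by move=> mm' al p pm; apply: al; exact: Pi_W pm. Qed.

Lemma ksum_fsub l l' x : ksum K (fsub l l') x = ksum K l x - ksum K l' x.
Proof.
rewrite /ksum /fsub big_cat big_map -sumrN; congr (_ + _).
by apply: eq_bigr => c _; rewrite mulNr.
Qed.

Section Approximation.
Variables (s : nat) (ns : (n < s)%N) (f : 'rV[R]_d -> R).
Variables (l : nat -> @fsupp R d) (p : nat -> mpoly d R).
Hypothesis approx : native_approx K s f l p.

Let F i : 'rV[R]_d -> R := ksum K (l i) \+ pfun (p i).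

Lemma Cn_native_approx i : Cn n (F i).
Proof. by apply: Cn_add; [exact: Cn_ksum|exact: Cn_pfun]. Qed.

(** The derivative at [x] is split into a functional [g x] that annihilates [Pi_ s] and a
    combination of values at fixed nodes. The first part is controlled by Cauchy-Schwarz and the
    Cauchy property in the semi-norm, the second by pointwise convergence. *)
Lemma native_uniform_cauchy L y (e : R) : (size L <= n)%N -> 0 < e ->
  exists n0, \forall x \near y, forall a b, (n0 <= a)%N -> (n0 <= b)%N ->
    `|dl L (F a) x - dl L (F b) x| <= e.
Proof.
move=> Ln e0; have [ann pPi cau ptw] := approx.
(* The order is [s] because the polynomial parts [p a] range over [Pi_ s]. *)
have [S Sm HS] := @interpolation R d s.
have CL c : Cn (size L) (pfun (R := R) c : 'rV[R]_d -> R) by exact: Cn_pfun.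
pose g x : seq (R * seq 'rV[R]_d) * @fsupp R d :=
  ([:: (1, L)], [seq (- dl L (pfun c.2) x, c.1) | c <- S]).
have gE x G : gapp x (g x) G = dl L G x - \sum_(c <- S) dl L (pfun c.2) x * G c.1.
  rewrite /gapp /dapp big_seq1 mul1r /fapply big_map -sumrN; congr (_ + _).
  by apply: eq_bigr => c _; rewrite /= mulNr.
have gs x q : Pi_ s q -> gapp x (g x) (pfun q) = 0.
  move=> qs; rewrite gE; apply/eqP; rewrite subr_eq0; apply/eqP.
  have -> : pfun q = (fun x => \sum_(c <- S) pfun q c.1 * pfun c.2 x).
    by apply/funext => w; rewrite {1}(HS _ qs).
  rewrite dl_sum => [|c _]; last exact: Cn_scale.
  by apply: eq_bigr => c _; rewrite dlZ// mulrC -HS.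
have ga x : gadm n x (g x).
  split=> [a|q qn]; first by rewrite inE => /eqP ->.
  by apply: gs; exact: Pi_W qn.
pose Q x := gform n nu x (g x) (g x).
have Q0 x : 0 <= Q x by exact: gform_psd.
(* Continuity bounds the norm of [g x] on a neighbourhood of [y], which makes the Cauchy estimate
   locally uniform. *)
have Qc : {for y, continuous Q}.
  have dc c : {for y, continuous (dl L (pfun c) : 'rV[R]_d -> R)} by exact: dl_continuous (CL c) _.
  have dk c : {for y, continuous (dl L (K ^~ c))}.
    by apply: dl_continuous; apply: CnW Ln _; exact: Cn_sphs_kernel.
  have QE : Q = fun x => \sum_(c <- S) - dl L (pfun c.2) x * (1 * dl L (K ^~ c.1) x) +
       \sum_(c <- S) - dl L (pfun c.2) x * (1 * dl L (K ^~ c.1) x) +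
       \sum_(c <- S) \sum_(c' <- S) - dl L (pfun c.2) x * - dl L (pfun c'.2) x * K c.1 c'.1.
    apply/funext => x; rewrite /Q /gform /g /= !big_map.
    congr (_ + _ + _); try by apply: eq_bigr => c _; rewrite /dapp big_seq1.
    by rewrite /kform big_map; apply: eq_bigr => c _; rewrite big_map.
  have FF : Filter (nbhs y) by exact: nbhs_filter.
  have t1 : (fun x => \sum_(c <- S) - dl L (pfun c.2) x * (1 * dl L (K ^~ c.1) x)) @ nbhs y -->
      \sum_(c <- S) - dl L (pfun c.2) y * (1 * dl L (K ^~ c.1) y).
    apply: (@cvgr_sum _ _ (nbhs y)) => c _; apply: cvgM; first by apply: cvgN; exact: dc.
    by apply: cvgMr; exact: dk.
  rewrite QE; apply: cvgD; first by apply: cvgD; exact: t1.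
  apply: (@cvgr_sum _ _ (nbhs y)) => c _; apply: (@cvgr_sum _ _ (nbhs y)) => c' _.
  by apply: cvgMl; apply: cvgM; apply: cvgN; exact: dc.
pose B (c : 'rV[R]_d * mpoly d R) : R := `|dl L (pfun c.2) y| + 1.
pose M := Num.sqrt (Q y + 1) + 1.
have M0 : 0 < M by rewrite ltr_wpDl// sqrtr_ge0.
have eM : 0 < e / 2 / M by rewrite !divr_gt0.
have [n1 Hn1] := cau _ eM.
(* The error of [F a] at the nodes, with weights [B c] that dominate the coefficients of the
   interpolation part near [y]. *)
pose T a : R := \sum_(c <- S) B c * `|F a c.1 - f c.1|.
have T0 : T @ \oo --> (0 : R).
  have : T @ \oo --> \sum_(c <- S) B c * `|f c.1 - f c.1|.
    apply: cvgr_sum => c _; apply: cvgMr; apply: cvg_norm; apply: cvgB; last exact: cvg_cst.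
    exact: ptw.
  by rewrite big1// => c _; rewrite subrr normr0 mulr0.
have e4 : 0 < e / 4 by rewrite divr_gt0.
have [n2 _ Hn2] : \forall a \near \oo, T a <= e / 4.
  move/cvgr0Pnorm_le : T0 => /(_ _ e4); apply: filterS => a.
  exact: le_trans (ler_norm _).
exists (maxn n1 n2).
have nearQ : \forall x \near y, Q x <= Q y + 1.
  have /cvgrPdist_le/(_ _ ltr01) := Qc.
  apply: filterS => x; rewrite distrC => /(le_trans (ler_norm _)).
  by rewrite lerBlDl.
have nearB : \forall x \near y, forall c, c \in S -> `|dl L (pfun c.2) x| <= B c.
  have near1 c : \forall x \near y, `|dl L (pfun c) x| <= `|dl L (pfun c) y| + 1.
    have dc : {for y, continuous (dl L (pfun c) : 'rV[R]_d -> R)} by exact: dl_continuous (CL c) _.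
    have /cvgrPdist_le/(_ _ ltr01) := dc.
    apply: filterS => x; rewrite distrC => h; rewrite -lerBlDl.
    exact: le_trans (lerB_dist _ _) h.
  elim: S {Sm HS g gE gs ga Q Q0 Qc M M0 eM n1 Hn1 T T0 n2 Hn2 nearQ} => [|c S IHS].
    by near=> x.
  have := near1 c.2; apply: filterS2 IHS => x HS Hc c'; rewrite inE => /predU1P[->//|].
  exact: HS.
apply: filterS2 nearQ nearB => x Qx Bx a b; rewrite !geq_max => /andP[a1 a2] /andP[b1 b2].
pose q := p a - p b.
have qs : Pi_ s q by exact: Pi_B.
pose H := fsub (l a) (l b).
have HE : F a = (F b \+ (ksum K H \+ pfun q)).
  by apply/funext => w; rewrite /F /= ksum_fsub pfunB; ring.
have CFn i : Cn (size L) (F i) by apply: CnW Ln _; exact: Cn_native_approx.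
have CH : Cn n (ksum K H \+ pfun q) by apply: Cn_add; [exact: Cn_ksum|exact: Cn_pfun].
have -> : dl L (F a) x - dl L (F b) x = dl L (ksum K H \+ pfun q) x.
  rewrite [in LHS]HE (dlD (CFn b) (CnW Ln CH)).
  by rewrite [X in X - _]/= addrAC subrr add0r.
have -> : dl L (ksum K H \+ pfun q) x = gapp x (g x) (ksum K H \+ pfun q) +
    \sum_(c <- S) dl L (pfun c.2) x * (ksum K H \+ pfun q) c.1.
  by rewrite gE subrK.
rewrite gappD; [|exact: (ga x).1|exact: Cn_ksum|exact: Cn_pfun].
rewrite gs// addr0 (_ : e = e / 2 + e / 2); last by field.
rewrite (le_trans (ler_normD _ _))// lerD//.
  have annH : annihilates n.+1 H.
    by apply: annihilatesW ns _; exact: annihilates_fsub.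
  rewrite (le_trans (gapp_ksum_le (ga x) annH))//.
  have h1 : Num.sqrt (Q x) <= M.
    by rewrite (@le_trans _ _ (Num.sqrt (Q y + 1))) ?ler_wsqrtr// /M lerDl.
  rewrite (le_trans (ler_pM _ _ h1 (ltW (Hn1 _ _ a1 b1)))) ?sqrtr_ge0//.
  by rewrite mulrC divfK// gt_eqF.
rewrite (@le_trans _ _ (T a + T b))//; last first.
  rewrite (_ : e / 2 = e / 4 + e / 4); last by field.
  by rewrite lerD//; exact: Hn2.
rewrite (le_trans (ler_norm_sum _ _ _))// /T -big_split big_seq [leRHS]big_seq.
apply: ler_sum => c cS /=.
have -> : ksum K H c.1 + pfun q c.1 = (F a c.1 - f c.1) - (F b c.1 - f c.1).
  by rewrite /F /= ksum_fsub pfunB; ring.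
rewrite normrM -mulrDr ler_pM//; first exact: Bx.
exact: ler_normB.
Unshelve. all: by end_near. Qed.

Lemma cvg_dl_native L y : (size L <= n)%N -> (fun i => dl L (F i) y) @ \oo --> dl L f y.
Proof.
move=> Ln; apply: (@cvg_dl _ _ F f n) => //.
- exact: Cn_native_approx.
- by have [_ _ _] := approx.
- by move=> L' Ln' y' e e0; exact: native_uniform_cauchy.
Qed.

(** The inequality [gapp_ksum_le] for the approximants, whose polynomial parts [g] kills, passes to
    the limit since their derivatives at [z] converge. *)
Lemma gapp_native_le z g (c : R) : gadm n z g -> (forall q, Pi_ s q -> gapp z g (pfun q) = 0) ->
  (fun i => Num.sqrt (ksqnorm K (l i))) @ \oo --> c ->
  `|gapp z g f| <= Num.sqrt (gform n nu z g g) * c.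
Proof.
move=> ga gs cc; have [ann pPi _ ptw] := approx.
have lim : (fun i => `|gapp z g (F i)|) @ \oo --> `|gapp z g f|.
  apply: cvg_norm; rewrite /gapp; apply: cvgD.
    rewrite /dapp big_seq; under eq_fun do rewrite big_seq.
    apply: cvgr_sum => a /ga.1 an; apply: cvgMr; exact: cvg_dl_native.
  by apply: cvgr_sum => x _; apply: cvgMr; exact: ptw.
have lim2 : (fun i => Num.sqrt (gform n nu z g g) * Num.sqrt (ksqnorm K (l i))) @ \oo -->
    Num.sqrt (gform n nu z g g) * c by exact: cvgMr cc.
apply: (ler_cvg_to lim lim2); apply: nearW => i.
rewrite gappD; [|exact: ga.1|exact: Cn_ksum|exact: Cn_pfun].
rewrite gs// addr0; apply: gapp_ksum_le => //.
exact: annihilatesW ns (ann i).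
Qed.

(** The reverse triangle inequality for the semi-norm, itself a consequence of Cauchy-Schwarz,
    carries the Cauchy property over to the norms. *)
Lemma is_cvg_native_norm : cvgn (fun i => Num.sqrt (ksqnorm K (l i))).
Proof.
have [ann _ cau _] := approx.
apply: cauchy_seq_cvg => e e0; have [n0 Hn0] := cau e e0; exists n0 => a b an bn.
have annl i : annihilates n.+1 (l i) by exact: annihilatesW ns (ann i).
have dist i j : `|Num.sqrt (ksqnorm K (l i)) - Num.sqrt (ksqnorm K (l j))| <=
    Num.sqrt (ksqnorm K (fsub (l i) (l j))).
  have ksq_ge0 h : annihilates n.+1 h -> 0 <= ksqnorm K h.
    by move=> ah; rewrite -(gform_ksqnorm 0); apply: gform_psd => //; exact: gadm_annihilates.
  have a0 := ksq_ge0 _ (annl i); have c0 := ksq_ge0 _ (annl j).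
  have := @gform_CS R d n nu nu_bounds 0 ([::], l i) ([::], l j)
    (gadm_annihilates 0 (annl i)) (gadm_annihilates 0 (annl j)).
  rewrite !gform_ksqnorm gform_kform => CS.
  have -> : ksqnorm K (fsub (l i) (l j)) =
      ksqnorm K (l i) + ksqnorm K (l j) - 2 * kform K (l i) (l j).
    rewrite -[ksqnorm _ _]/(kform K (fsub (l i) (l j)) (fsub (l i) (l j))).
    rewrite kform_fsubl !(kformC _ _ _ (fsub _ _)) !kform_fsubl (kformC _ _ (l j) (l i)).
    by rewrite -![ksqnorm _ _]/(kform _ _ _); ring.
  rewrite -sqrtr_sqr ler_wsqrtr// sqrrB !sqr_sqrtr// -sqrtrM// addrAC lerB//.
  rewrite -[leRHS]mulr_natl ler_pM2l// (le_trans (ler_norm _))// -sqrtr_sqr.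
  exact: ler_wsqrtr.
exact: le_trans (dist a b) (ltW (Hn0 _ _ an bn)).
Qed.

End Approximation.
End NativeSpace.

(** * Taylor remainders and the growth function *)

Section LineDerivatives.
Context {R : realType} {d : nat}.
Implicit Types (F : 'rV[R]_d -> R) (x y z v : 'rV[R]_d) (p : mpoly d R).

(** The falling factorial of a real number; divided by j! it is the generalised binomial
    coefficient. *)
Definition falling (e : R) (j : nat) : R := \prod_(i < j) (e - i%:R).

Lemma fallingS e j : falling e j.+1 = falling e j * (e - j%:R).
Proof. by rewrite /falling big_ord_recr. Qed.

Lemma falling_rec e j : falling e j.+1 = e * falling (e - 1) j.
Proof.
rewrite /falling big_ord_recl subr0; congr (_ * _); apply: eq_bigr => i _.
by rewrite -addrA -opprD nat1r.
Qed.

Lemma is_derive_line_val F x v (g : R -> R) (dg : R) (t : R) :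
  derivable F (x + t *: v) v -> (\near t, F (x + t *: v) = g t) -> is_derive t 1 g dg ->
  'D_v F (x + t *: v) = dg.
Proof.
move=> dF Fg [_ <-].
have [_ <-] := is_derive_line dF.
exact: near_eq_derive.
Qed.

Lemma dl_line_horner F x v (P : {poly R}) j : Cn j F ->
  (forall t, F (x + t *: v) = P.[t]) ->
  forall t, dl (nseq j v) F (x + t *: v) = P^`(j).[t].
Proof.
move=> + FP; elim: j => [_|j IHj CF] t; first by rewrite derivn0 -FP.
rewrite derivnS [LHS]/=.
apply: (@is_derive_line_val (dl (nseq j v) F) x v (horner P^`(j))).
- by apply: dl_derivable; rewrite size_nseq.
- by near=> u; apply: IHj; exact: CnS.
Unshelve. all: by end_near. Qed.

(** Serves both for the kernel along the segment from [z] to a node and for the kernel function on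
    the two halves of a coordinate axis. *)
Lemma dl_line_powR F x v (sg b c e : R) j : Cn j F ->
  (forall t, 0 < sg * t + b -> F (x + t *: v) = c * (sg * t + b) `^ e) ->
  forall t, 0 < sg * t + b ->
    dl (nseq j v) F (x + t *: v) = c * sg ^+ j * falling e j * (sg * t + b) `^ (e - j%:R).
Proof.
move=> + Fe; elim: j => [_|j IHj CF] t t0.
  by rewrite /= Fe// expr0 mulr1 /falling big_ord0 mulr1 subr0.
pose g u := c * sg ^+ j * falling e j * (sg * u + b) `^ (e - j%:R).
have da : is_derive t 1 (fun u : R => sg * u + b) sg.
  rewrite (_ : (fun u => _) = sg \*: id + cst b); last by apply/funext => u.
  by apply: is_derive_eq; rewrite addr0 /GRing.scale /= mulr1.
have dp : is_derive (sg * t + b) 1 (fun u => u `^ (e - j%:R))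
    ((e - j%:R) * (sg * t + b) `^ (e - j%:R - 1)).
  apply: DeriveDef; first by apply: derivable_powR; rewrite in_itv /= t0.
  by rewrite -derive1E powR_derive1// in_itv /= t0.
have dg : is_derive t 1 g
    (c * sg ^+ j * falling e j * ((e - j%:R) * (sg * t + b) `^ (e - j%:R - 1) * sg)).
  have dc : is_derive t 1 ((fun u => u `^ (e - j%:R)) \o (fun u : R => sg * u + b))
      ((e - j%:R) * (sg * t + b) `^ (e - j%:R - 1) * sg).
    apply: DeriveDef.
      apply/derivable1_diffP; apply: differentiable_comp; apply/derivable1_diffP.
        by have [] := da.
      by have [] := dp.
    rewrite -derive1E derive1_comp; [|by have [] := da|by have [] := dp].
    by rewrite !derive1E; have [_ ->] := da; have [_ ->] := dp.
  rewrite (_ : g = (c * sg ^+ j * falling e j) \*: ((fun u => u `^ (e - j%:R)) \o (fun u : R => sg * u + b))).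
    exact: is_derive_eq.
  by apply/funext.
have E := @is_derive_line_val (dl (nseq j v) F) x v g _ t _ _ dg.
rewrite /= E.
- rewrite fallingS exprSr (_ : e - j.+1%:R = e - j%:R - 1); last by rewrite -natr1; ring.
  by ring.
- by apply: dl_derivable; rewrite size_nseq.
near=> u; apply: IHj; first exact: CnS.
near: u.
have ca : {for t, continuous (fun u : R => sg * u + b)}.
  by apply/differentiable_continuous/derivable1_diffP; have [] := da.
by apply: (cvgr_gt _ ca); exact: t0.
Unshelve. all: by end_near. Qed.

Definition line_poly p x v (k : nat) : {poly R} :=
  \sum_(u : bmultinom d k) mcoeff u p *: \prod_(i < d) ((x ord0 i)%:P + v ord0 i *: 'X) ^+ u i.

Lemma line_polyE p x v k t : Pi_ k p -> (line_poly p x v k).[t] = pfun p (x + t *: v).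
Proof.
move=> pk.
have pE : p = \sum_(u : bmultinom d k) mcoeff u p *: mpolyX R (val u) by exact: mpolywE.
rewrite [in RHS]pE pfun_sum horner_sum; apply: eq_bigr => u _.
rewrite hornerZ pfunZ; congr (_ * _).
rewrite horner_prod /pfun mevalX; apply: eq_bigr => i _.
by rewrite horner_exp !hornerE !mxE mulrC.
Qed.

Lemma size_line_poly p x v k : (size (line_poly p x v k) <= k)%N.
Proof.
apply: (leq_trans (size_sum _ _ _)); apply/bigmax_leqP => u _.
apply: (leq_trans (size_scale_leq _ _)); apply: leq_trans (bmdeg u).
rewrite mdegE.
apply: (big_ind2 (fun (q : {poly R}) m => (size q <= m.+1)%N)) => [|q1 m1 q2 m2 h1 h2|i _].
- by rewrite size_poly1.
- apply: (leq_trans (size_polyMleq _ _)).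
  have h : (size q1 + size q2 <= m1.+1 + m2.+1)%N by rewrite leq_add.
  by rewrite -ltnS; case: (size q1 + size q2)%N h => // m; rewrite addSn addnS.
apply: (leq_trans (size_poly_exp_leq _ _)); rewrite ltnS.
rewrite -[leqRHS]mul1n leq_mul2r; apply/orP; right.
rewrite -subn1 leq_subLR (leq_trans (size_polyD _ _))// geq_max.
rewrite (leq_trans (size_polyC_leq1 _))//=.
by rewrite (leq_trans (size_scale_leq _ _))// size_polyX.
Qed.

(** Restriction to the line through [x] in direction [v] reduces this to the univariate Taylor
    formula. *)
Lemma taylor_pfun k p x v : Pi_ k p ->
  pfun p (x + v) = \sum_(j < k) (j`!%:R)^-1 * dl (nseq j v) (pfun p) x.
Proof.
move=> pk; rewrite -[in LHS](scale1r v) -(line_polyE x v 1 pk) -[X in _.[X] = _]add0r.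
rewrite (@nderiv_taylor_wide _ k); [|exact: mulrC|exact: size_line_poly].
apply: eq_bigr => j _; rewrite expr1n mulr1.
have := @dl_line_horner (pfun p) x v (line_poly p x v k) j (Cn_pfun j p).
move=> /(_ (fun t => esym (line_polyE x v t pk)) 0).
rewrite scale0r addr0 => ->.
by rewrite nderivn_def hornerMn -[X in _ * X]mulr_natl mulrA mulVf ?mul1r// pnatr_eq0 -lt0n fact_gt0.
Qed.

End LineDerivatives.

(** The alternating partial sum of a row of Pascal's triangle with real upper index; it is the
    source of binom(nu - 1, n) in the bound. *)
Lemma sum_falling (R : realType) (e : R) n :
  \sum_(j < n.+1) (-1) ^+ j * falling e j / j`!%:R = (-1) ^+ n * falling (e - 1) n / n`!%:R.
Proof.
elim: n => [|n IHn]; first by rewrite big_ord1 /falling !big_ord0.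
rewrite big_ord_recr IHn /= falling_rec fallingS factS natrM exprS.
have f0 : n`!%:R != 0 :> R by rewrite pnatr_eq0 -lt0n fact_gt0.
have n1 : n.+1%:R != 0 :> R by rewrite pnatr_eq0.
by rewrite -natr1 in n1 *; field; rewrite f0.
Qed.

(** * The norm of the error functional and the growth function *)

Section PowerFunction.
Context {R : realType} {d : nat}.
Variables (n : nat) (nu : R).
Hypothesis nu_bounds : 2 * n%:R < nu < 2 * n.+1%:R.
Implicit Types (F G : 'rV[R]_d -> R) (x y z v : 'rV[R]_d) (L : seq 'rV[R]_d).
Implicit Types (w l : @fsupp R d) (A : seq (R * seq 'rV[R]_d)) (p : mpoly d R).
Local Notation K := (@sphs_kernel R d n nu).

Definition taylor_op v : seq (R * seq 'rV[R]_d) :=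
  [seq ((j`!%:R)^-1, nseq j v) | j <- iota 0 n.+1].

Lemma dapp_taylor z v F :
  dapp z (taylor_op v) F = \sum_(j < n.+1) (j`!%:R)^-1 * dl (nseq j v) F z.
Proof. by rewrite /dapp /taylor_op big_map -[iota _ _]/(index_iota 0 n.+1) big_mkord. Qed.

Lemma taylor_op_size v a : a \in taylor_op v -> (size a.2 <= n)%N.
Proof. by move=> /mapP[j]; rewrite mem_iota add0n ltnS => /andP[_ jn] ->; rewrite size_nseq. Qed.

Definition neg_op A : seq (R * seq 'rV[R]_d) := [seq (- a.1, a.2) | a <- A].

Lemma dapp_neg z A F : dapp z (neg_op A) F = - dapp z A F.
Proof. by rewrite /dapp big_map -sumrN; apply: eq_bigr => a _; rewrite mulNr. Qed.

(** The functional which sends F to F(x) minus the value at x of its Taylor polynomial of degree [n]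
    at [z]. *)
Definition remainder z x : seq (R * seq 'rV[R]_d) * @fsupp R d :=
  (neg_op (taylor_op (x - z)), [:: (1, x)]).

Lemma gadm_remainder z x : gadm n z (remainder z x).
Proof.
split=> [a /mapP[a' /taylor_op_size ? ->]//|p pn].
rewrite /gapp dapp_neg dapp_taylor -taylor_pfun// addrC subrKC.
by rewrite /fapply big_seq1 mul1r subrr.
Qed.

(** On the segment from [z] to [x] the kernel is a constant times (1 - t)^nu. *)
Lemma dl_kernel z x j : (j <= n)%N ->
  dl (nseq j (x - z)) (K ^~ x) z =
  (-1) ^+ n.+1 * enorm (x - z) `^ nu * ((-1) ^+ j * falling nu j).
Proof.
move=> jn.
have CK : Cn j (K ^~ x) by apply: CnW jn _; exact: Cn_sphs_kernel.
have := @dl_line_powR _ _ (K ^~ x) z (x - z) (-1) 1 ((-1) ^+ n.+1 * enorm (x - z) `^ nu) nu j CK.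
move=> H; have := H _ 0.
rewrite mulr0 add0r ltr01 scale0r addr0 powR1 mulr1 => -> //; first by rewrite mulrA.
move=> t t1.
have -> : K (z + t *: (x - z)) x = sphs n nu ((-1 * t + 1) *: (x - z)).
  rewrite sphs_kernelC /sphs_kernel; congr (sphs _ _ _).
  by rewrite opprD addrA scalerDl scale1r mulN1r scaleNr addrC.
by rewrite sphsZ ?ltW// /sphs; ring.
Qed.

(** Since K(x, x) = 0, only the two equal cross terms remain, and they are evaluated by [dl_kernel]
    and [sum_falling]; the signs cancel. *)
Lemma gform_remainder z x :
  gform n nu z (remainder z x) (remainder z x) =
  2 * (falling (nu - 1) n / n`!%:R) * enorm (x - z) `^ nu.
Proof.
have nu0 := nu_gt0 nu_bounds.
have gE B : gform n nu z (B, [:: (1, x)]) (B, [:: (1, x)]) =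
    dapp z B (K ^~ x) + dapp z B (K ^~ x) + K x x.
  by rewrite /gform /kform /= !big_seq1 /= !mul1r.
rewrite gE dapp_neg dapp_taylor.
have -> : K x x = 0.
  rewrite /sphs_kernel subrr /sphs.
  by rewrite enorm_powR (eqP (_ : sqn 0 == 0)) ?sqn_eq0// powR0 ?mulr0// mulf_neq0 ?gt_eqF// invr_gt0.
rewrite addr0.
have -> : \sum_(j < n.+1) (j`!%:R)^-1 * dl (nseq j (x - z)) (K ^~ x) z =
    (-1) ^+ n.+1 * enorm (x - z) `^ nu * \sum_(j < n.+1) (-1) ^+ j * falling nu j / j`!%:R.
  rewrite mulr_sumr; apply: eq_bigr => j _.
  by rewrite dl_kernel -1?ltnS ?ltn_ord//; ring.
rewrite sum_falling exprS.
have s1 : (-1) ^+ n * (-1) ^+ n = 1 :> R by rewrite -exprMn mulrNN mulr1 expr1n.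
rewrite [LHS](_ : _ = ((-1) ^+ n * (-1) ^+ n) * (2 * (falling (nu - 1) n / n`!%:R) * enorm (x - z) `^ nu)); last by ring.
by rewrite s1 mul1r.
Qed.

Definition scale_op (c : R) A : seq (R * seq 'rV[R]_d) := [seq (c * a.1, a.2) | a <- A].

Lemma dapp_scale z c A F : dapp z (scale_op c A) F = c * dapp z A F.
Proof. by rewrite /dapp big_map mulr_sumr; apply: eq_bigr => a _; rewrite mulrA. Qed.

Lemma dappB z A F G : (forall a, a \in A -> (size a.2 <= n)%N) -> Cn n F -> Cn n G ->
  dapp z A (fun x => F x - G x) = dapp z A F - dapp z A G.
Proof.
move=> An CF CG.
have gE H : dapp z A H = gapp z (A, [::]) H by rewrite /gapp /fapply big_nil addr0.
rewrite !gE -mulN1r -(@gappZ R d n z (A, [::]) (-1) G An CG).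
rewrite -(@gappD R d n z (A, [::]) F _ An CF (Cn_scale (-1) CG)).
by congr gapp; apply/funext => x /=; rewrite mulN1r.
Qed.

Lemma dapp_pfun_sum z A (I : Type) (r : seq I) (P : pred I) (c : I -> R) (q : I -> mpoly d R) :
  dapp z A (pfun (\sum_(i <- r | P i) c i *: q i)) = \sum_(i <- r | P i) c i * dapp z A (pfun (q i)).
Proof.
rewrite (_ : pfun _ = fun x => \sum_(i <- r | P i) c i * pfun (q i) x); last first.
  by apply/funext => x; rewrite pfun_sum; apply: eq_bigr => i _; rewrite pfunZ.
rewrite /dapp; under [RHS]eq_bigr do rewrite mulr_sumr.
rewrite [RHS]exchange_big /=; apply: eq_bigr => a _.
rewrite dl_sum => [|i _]; last by apply: Cn_scale; exact: Cn_pfun.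
rewrite mulr_sumr; apply: eq_bigr => i _.
rewrite dlZ; last exact: Cn_pfun.
exact: mulrCA.
Qed.

(* A combination of derivatives at [z] which vanishes on polynomials has zero
   [gform] norm; by Cauchy-Schwarz it vanishes on the kernel part of [h], which
   is the compatibility condition of this linear system. *)
Lemma hermite_interpolation z (k : nat) (As : 'I_k -> seq (R * seq 'rV[R]_d)) h :
  (forall i a, a \in As i -> (size a.2 <= n)%N) -> gadm n z h ->
  exists2 q, Pi_ n.+1 q & forall i, dapp z (As i) (pfun q) = dapp z (As i) (ksum K h.2).
Proof.
move=> An hadm.
pose X (u : bmultinom d n.+1) : mpoly d R := mpolyX R (val u).
have XPi u : Pi_ n.+1 (X u) by rewrite /Pi_ /X /= msizeX bmdeg.
pose M : 'M[R]_(#|{: bmultinom d n.+1}|, k) :=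
  \matrix_(u, i) dapp z (As i) (pfun (X (enum_val u))).
pose G : 'rV[R]_k := \row_i dapp z (As i) (ksum K h.2).
have GM : (G <= M)%MS.
  (* A column of the cokernel of [M] is a set of coefficients for which the combination of the
     operators [As i] kills all monomials of degree at most [n]. *)
  rewrite submxE; apply/eqP/rowP => j; rewrite !mxE.
  pose c i := cokermx M i j.
  pose g : seq (R * seq 'rV[R]_d) * @fsupp R d :=
    (flatten [seq scale_op (c i) (As i) | i <- enum 'I_k], [::]).
  have gE F : dapp z g.1 F = \sum_i c i * dapp z (As i) F.
    rewrite /dapp big_flatten big_map big_enum; apply: eq_bigr => i _.
    exact: dapp_scale.
  have gp u : dapp z g.1 (pfun (X u)) = 0.
    have /matrixP/(_ (enum_rank u) j) := mulmx_coker M.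
    rewrite !mxE => Mc; rewrite gE; apply: (etrans _ Mc); apply: eq_bigr => i _.
    by rewrite mxE enum_rankK mulrC.
  have ga : gadm n z g.
    split=> [a /flattenP[A /mapP[i _ ->] /mapP[a' /An ? ->]]//|p pn].
    rewrite /gapp /fapply big_nil addr0.
    have -> : p = \sum_(u : bmultinom d n.+1) mcoeff u p *: X u by exact: mpolywE.
    by rewrite dapp_pfun_sum big1// => u _; rewrite gp mulr0.
  have := gform_CS nu_bounds ga hadm.
  (* There is no point part in [g], and [gform] leaves out pairs of derivatives. *)
  have -> : gform n nu z g g = 0 by rewrite /gform /kform !big_nil !addr0.
  rewrite mul0r => CS.
  have gh0 : gform n nu z g h = 0.
    by apply/eqP; rewrite -sqrf_eq0 eq_le CS sqr_ge0.
  have : gapp z g (ksum K h.2) = 0.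
    rewrite (gapp_ksum nu_bounds) -?gh0; last exact: ga.1.
    by rewrite /gform /kform /= !big_nil.
  rewrite /gapp /fapply big_nil addr0 gE => g0.
  by apply: (etrans _ g0); apply: eq_bigr => i _; rewrite mxE mulrC.
have [D GD] := submxP GM.
exists (\sum_(u : bmultinom d n.+1) D ord0 (enum_rank u) *: X u).
  by apply: Pi_sum => u _; apply: Pi_Z.
move=> i; rewrite dapp_pfun_sum.
have := congr1 (fun m : 'rV[R]_k => m ord0 i) GD.
rewrite !mxE => ->.
rewrite [RHS](reindex (fun u : bmultinom d n.+1 => enum_rank u)) /=; last first.
  by exists enum_val => u _; [exact: enum_rankK|exact: enum_valK].
by apply: eq_bigr => u _; rewrite mxE enum_rankK.
Qed.

Lemma gform_growth z A (N : nat) (X : 'I_N -> 'rV[R]_d) (w : 'I_N -> R) p (s : nat) :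
  let h := (A, [seq (- w j, X j) | j <- enum 'I_N]) in
  (n < s)%N -> gadm n z h -> gapp z h (pfun p) = 0 -> Pi_ s p ->
  (forall j, dapp z A (K ^~ (X j)) - \sum_(i < N) w i * K (X j) (X i) = pfun p (X j)) ->
  exists q, [/\ Pi_ s q, dapp z A (pfun q) = gform n nu z h h &
    forall j, `|pfun q (X j)| <=
      Num.sqrt (2 * (falling (nu - 1) n / n`!%:R)) * enorm (X j - z) `^ (nu / 2) *
      Num.sqrt (gform n nu z h h)].
Proof.
move=> h ns hadm hp ps sys.
have An : forall a, a \in A -> (size a.2 <= n)%N by exact: hadm.1.
(* Index [ord0] prescribes the value of [A], and the other indices the Taylor polynomials towards
   the nodes, so that a single [q] meets all the conditions. *)
pose As (i : 'I_N.+1) : seq (R * seq 'rV[R]_d) :=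
  if unlift ord0 i is Some j then taylor_op (X j - z) else A.
have [|q qn Hq] := @hermite_interpolation z N.+1 As h _ hadm.
  by move=> i a; rewrite /As; case: unliftP => [j _|_]; [exact: taylor_op_size|exact: An].
have HqA : dapp z A (pfun q) = dapp z A (ksum K h.2).
  by have := Hq ord0; rewrite /As unlift_none.
have HqX j : pfun q (X j) = dapp z (taylor_op (X j - z)) (ksum K h.2).
  have := Hq (lift ord0 j); rewrite /As liftK => <-.
  by rewrite dapp_taylor -taylor_pfun// addrC subrK.
have ksumE x : ksum K h.2 x = - \sum_(i < N) w i * K x (X i).
  by rewrite /ksum big_map big_enum -sumrN; apply: eq_bigr => i _; rewrite mulNr.
have dkE B : (forall a, a \in B -> (size a.2 <= n)%N) ->
    dapp z B (ksum K h.2) = \sum_(c <- h.2) c.1 * dapp z B (K ^~ c.2).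
  move=> Bn; have := @gapp_ksum _ _ n nu nu_bounds z (B, [::]) h.2 Bn.
  by rewrite /gapp /gform /fapply /kform /= !big_nil !addr0.
(* The system [sys] turns the point-point part of the form into values of [p] at the nodes, and [hp]
   turns their weighted sum into [dapp z A (pfun p)]. *)
have P2 : gform n nu z h h = dapp z A (pfun q) - dapp z A (pfun p).
  have -> : gform n nu z h h = dapp z A (ksum K h.2) + dapp z A (ksum K h.2) + kform K h.2 h.2.
    by rewrite dkE.
  have -> : kform K h.2 h.2 = fapply h.2 (pfun p) - dapp z A (ksum K h.2).
    rewrite kformE dkE// /fapply -sumrB big_map [RHS]big_map; apply: eq_bigr => j _ /=.
    rewrite -sys -mulrBr; congr (_ * _).
    rewrite [RHS](_ : _ = ksum K h.2 (X j)); last by rewrite ksumE; ring.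
    rewrite /fapply /ksum; apply: eq_bigr => c _.
    by rewrite sphs_kernelC.
  rewrite HqA.
  have -> : fapply h.2 (pfun p) = - dapp z A (pfun p).
    by apply/eqP; rewrite -addr_eq0 addrC; apply/eqP.
  by ring.
exists (q - p); split.
- by apply: Pi_B => //; exact: Pi_W qn.
- rewrite P2 -dappB//; try exact: Cn_pfun.
  by congr dapp; apply/funext => x; rewrite pfunB.
move=> j.
have CS := gform_CS nu_bounds (gadm_remainder z (X j)) hadm.
(* Pairing the Taylor remainder at a node with [h] evaluates [p - q] there, by the choice of [q] and
   by [sys]. *)
have E : gform n nu z (remainder z (X j)) h = pfun p (X j) - pfun q (X j).
  rewrite /gform /= big_seq1 mul1r /=.
  have -> : \sum_(c <- h.2) c.1 * dapp z (neg_op (taylor_op (X j - z))) (K ^~ c.2) = - pfun q (X j).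
    rewrite HqX dkE; last exact: taylor_op_size.
    by rewrite -sumrN; apply: eq_bigr => c _; rewrite dapp_neg mulrN.
  have -> : kform K [:: (1, X j)] h.2 = ksum K h.2 (X j).
    by rewrite /kform big_seq1 /ksum; apply: eq_bigr => c _; rewrite mul1r.
  by rewrite -sys ksumE; ring.
rewrite pfunB distrC -E -sqrtr_sqr.
apply: (le_trans (ler_wsqrtr CS)).
have h0 : 0 <= gform n nu z h h by exact: gform_psd.
rewrite sqrtrM; last by apply: gform_psd => //; exact: gadm_remainder.
rewrite ler_wpM2r ?sqrtr_ge0// gform_remainder.
have c0 : 0 <= 2 * (falling (nu - 1) n / n`!%:R).
  rewrite mulr_ge0// divr_ge0// prodr_ge0// => i _.
  have /andP[n2 _] := nu_bounds.
  have := ltn_ord i; rewrite -(ler_nat R) -natr1 => i1.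
  have n0 : 0 <= i%:R :> R by [].
  by lra.
rewrite sqrtrM// ler_wpM2l ?sqrtr_ge0//.
by rewrite -powR12_sqrt ?powR_ge0// -powRrM.
Qed.

End PowerFunction.

(** * Constants and the Hoelder seminorm *)

Section Constants.
Context {R : realType}.
Implicit Types (e b g : R) (n : nat).

Lemma falling_add e i j : falling e (i + j) = falling e i * falling (e - i%:R) j.
Proof.
rewrite /falling big_split_ord /=; congr (_ * _); apply: eq_bigr => l _.
by rewrite natrD opprD addrA.
Qed.

Lemma falling_gt0 e j : j%:R - 1 < e -> 0 < falling e j.
Proof.
move=> je; apply: prodr_gt0 => i _; rewrite subr_gt0 (le_lt_trans _ je)//.
by rewrite lerBrDr natr1 ler_nat.
Qed.

(** Induction on [n]: the ratios of consecutive values of the two sides are compared, and the base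
    case amounts to b^2 <= 4. *)
Lemma prod_half_le b n : 0 < b <= 2 ->
  \prod_(1 <= j < n.+2) (b / 2 + j%:R) ^+ 2 <=
  n.+1`!%:R * (2 * n.+1%:R + b) * falling (n%:R + b) n.
Proof.
move=> /andP[b0 b2]; elim: n => [|n IHn].
  rewrite big_nat1 /falling big_ord0 mulr1 factS fact0 muln1.
  nra.
rewrite big_nat_recr //=.
apply: (le_trans (ler_wpM2r (sqr_ge0 _) IHn)).
rewrite falling_rec (_ : n.+1%:R + b - 1 = n%:R + b); last by rewrite -natr1; ring.
have f0 : 0 < falling (n%:R + b) n by apply: falling_gt0; lra.
have g0 : 0 < n.+1`!%:R :> R by rewrite ltr0n fact_gt0.
rewrite [n.+2`!]factS natrM.
have n0 : 0 <= n%:R :> R by [].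
set N := n%:R in n0 *.
have -> : n.+2%:R = N + 2 :> R by rewrite /N -addn2 natrD.
have -> : n.+1%:R = N + 1 :> R by rewrite /N -addn1 natrD.
set f := falling _ _ in f0 *; set g := _%:R in g0 *.
rewrite (_ : g * (2 * (N + 1) + b) * f * (b / 2 + (N + 2)) ^+ 2 =
  (g * f) * ((2 * (N + 1) + b) * (b / 2 + (N + 2)) ^+ 2)); last by ring.
rewrite (_ : (N + 2) * g * (2 * (N + 2) + b) * ((N + 1 + b) * f) =
  (g * f) * ((N + 2) * (2 * (N + 2) + b) * (N + 1 + b))); last by ring.
rewrite ler_pM2l ?mulr_gt0//.
(* Both sides share the factor [2 * (N + 2) + b]; the remaining factors differ by b (2 - b) / 4,
   which is nonnegative. *)
rewrite (_ : (2 * (N + 1) + b) * (b / 2 + (N + 2)) ^+ 2 =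
  (2 * (N + 2) + b) * ((N + 1 + b / 2) * (b / 2 + (N + 2)))); last by field.
rewrite (_ : (N + 2) * _ * _ = (2 * (N + 2) + b) * ((N + 2) * (N + 1 + b))); last by ring.
by rewrite ler_pM2l; nra.
Qed.

(** The right side contains the falling factorial of the left side as a block of consecutive
    factors; cancelling it leaves [prod_half_le]. *)
Lemma falling_half_le b n : 0 < b <= 2 ->
  falling (2 * n%:R + b - 1) n / n`!%:R * \prod_(1 <= j < n.+1) (b / 2 + j%:R) ^+ 2 <=
  falling (2 * n%:R + b) n.*2.
Proof.
move=> bb; have /andP[b0 b2] := bb; case: n => [|n].
  by rewrite big_geq// /falling !big_ord0 divr1 mulr1.
set nu := 2 * n.+1%:R + b.
have f0 : 0 < n.+1`!%:R :> R by rewrite ltr0n fact_gt0.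
have n0 : 0 <= n%:R :> R by [].
have nE : n.+1%:R = n%:R + 1 :> R by rewrite natr1.
have g0 : 0 < falling (nu - 1) n.+1 by apply: falling_gt0; rewrite /nu nE; lra.
rewrite doubleS [leRHS]falling_rec (_ : n.*2.+1 = n.+1 + n)%N; last by rewrite addSn addnn.
rewrite [falling _ (n.+1 + n)]falling_add (_ : nu - 1 - n.+1%:R = n%:R + b); last by rewrite /nu nE; ring.
have := prod_half_le n bb; rewrite -/nu.
move: (falling (nu - 1) n.+1) (falling (n%:R + b) n) (\prod_(_ <= _ < _) _) g0 => F1 F2 P g0 PF.
rewrite (_ : F1 / _ * P = F1 * (P / n.+1`!%:R)); last by ring.
by rewrite [leRHS]mulrCA ler_pM2l// ler_pdivrMr// [leRHS]mulrC mulrA.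
Qed.

(** Young's inequality with exponents 1 / g and 1 / (1 - g), applied to the product of 2^g and 1. *)
Lemma powR2_le g : 0 < g <= 1 -> 2 `^ g <= 1 + g.
Proof.
move=> /andP[g0]; rewrite le_eqVlt => /predU1P[->|g1]; first by rewrite powRr1.
have g1' : 0 < 1 - g by rewrite subr_gt0.
have := @conjugate_powR R (2 `^ g) 1 g^-1 (1 - g)^-1 (powR_ge0 _ _) ler01.
rewrite !invr_gt0 !invrK => /(_ g0 g1').
rewrite addrC subrK => /(_ erefl).
rewrite mulr1 powR1 -powRrM mulfV ?gt_eqF// powRr1// => h.
by apply: (le_trans h); lra.
Qed.

(* The Hoelder quotient of the [r]-th derivative of [|t| `^ nu] at the points
   [t] and [0] if [r] is even, [t] and [-t] if [r] is odd. *)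
Definition axis_seminorm (nu g : R) (r : nat) : R :=
  (if odd r then 2 / 2 `^ g else 1) * falling nu r.

(** With [n] for [r./2], one has nu = 2 n + b, where b is [g] for even [r] and [1 + g] for odd [r];
    this b / 2 is the shift in the products of [Cdr], so [falling_half_le] applies. The power of [d]
    is bounded below by 1. *)
Lemma falling_le_Cdr (d r : nat) (nu g : R) : (0 < d)%N -> nu = r%:R + g -> 0 < g <= 1 ->
  2 * (falling (nu - 1) r./2 / r./2`!%:R) <= Cdr d r g * axis_seminorm nu g r.
Proof.
move=> d0 nuE gg; have /andP[g0 g1] := gg.
have d1 : 1 <= d%:R `^ (r%:R / 2) :> R.
  apply: (@le_trans _ _ (1 `^ (r%:R / 2))); first by rewrite powR1.
  by rewrite ge0_ler_powR ?nnegrE ?divr_ge0// ler1n.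
rewrite /Cdr /axis_seminorm; case: ifP => r_odd.
  have rE : r = r./2.*2.+1 by rewrite -{1}(odd_double_half r) r_odd.
  set n := r./2 in rE *.
  have nu2 : nu = 2 * n%:R + (1 + g).
    by rewrite nuE rE -natr1 -muln2 natrM; ring.
  have bb : 0 < 1 + g <= 2 by apply/andP; split; lra.
  have := falling_half_le n bb; rewrite -nu2.
  set P := \prod_(_ <= _ < _) _; set F := falling (nu - 1) n / _ => FP.
  have P0 : 0 < P by apply: prodr_gt0 => i _; rewrite exprn_gt0// ltr_pwDl ?divr_gt0//; lra.
  have FE : falling nu r = falling nu n.*2 * (1 + g).
    by rewrite rE fallingS nu2 -muln2 natrM; congr (_ * _); ring.
  have G0 : 0 < falling nu n.*2.
    by apply: falling_gt0; rewrite nu2 -muln2 natrM; lra.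
  rewrite FE.
  have p2 : 0 < 2 `^ g :> R by exact: powR_gt0.
  (* For odd [r] the factor 2 absent from [Cdr] comes from the Hoelder quotient at opposite points,
     at the cost of 2^g <= 1 + g. *)
  have h : 2 * falling nu n.*2 <= 2 / 2 `^ g * (falling nu n.*2 * (1 + g)).
    rewrite (_ : 2 / _ * _ = 2 * falling nu n.*2 * ((1 + g) / 2 `^ g)); last by ring.
    rewrite ler_peMr ?mulr_ge0 ?(ltW G0)// ler_pdivlMr// mul1r.
    exact: powR2_le.
  rewrite [leRHS]mulrAC ler_pdivlMr//.
  apply: (@le_trans _ _ (2 * falling nu n.*2)); first by rewrite -mulrA ler_pM2l.
  apply: (le_trans h); rewrite ler_peMl//.
  by rewrite mulr_ge0 ?divr_ge0 ?powR_ge0// mulr_ge0 ?ltW//; lra.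
have rE : r = r./2.*2 by rewrite -{1}(odd_double_half r) r_odd.
set n := r./2 in rE *.
have nu2 : nu = 2 * n%:R + g by rewrite nuE rE -muln2 natrM mulrC.
have bb : 0 < g <= 2 by apply/andP; split; lra.
have := falling_half_le n bb; rewrite -nu2 -rE.
set P := \prod_(_ <= _ < _) _; set F := falling (nu - 1) n / _ => FP.
have P0 : 0 < P by apply: prodr_gt0 => i _; rewrite exprn_gt0// ltr_pwDl ?divr_gt0.
have G0 : 0 < falling nu r by apply: falling_gt0; lra.
rewrite mul1r [leRHS]mulrAC ler_pdivlMr// -!mulrA ler_pM2l//.
by rewrite mulrA; apply: (le_trans FP); rewrite ler_peMl// ltW.
Qed.

End Constants.

(** * A lower bound for the Hoelder seminorm on a coordinate axis *)

Section AxisSeminorm.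
Context {R : realType} {d : nat}.
Implicit Types (F : 'rV[R]_d -> R) (alpha : multinom d).

Definition multi_list alpha : seq 'rV[R]_d :=
  flatten [seq nseq (alpha i) (delta_mx ord0 i) | i <- enum 'I_d].

Lemma mpartialE alpha F : mpartial alpha F = dl (multi_list alpha) F.
Proof.
rewrite /mpartial /multi_list; elim: (enum 'I_d) => //= i e ->.
rewrite /dl foldr_cat.
by elim: (alpha i) => //= m ->.
Qed.

Lemma size_multi_list alpha : size (multi_list alpha) = mdeg alpha.
Proof.
rewrite size_flatten /shape -map_comp sumnE big_map mdegE big_enum.
by apply: eq_bigr => i _ /=; rewrite size_nseq.
Qed.

Definition diffop_list k (a : multinom d -> 'rV[R]_d -> R) z : seq (R * seq 'rV[R]_d) :=
  map (fun u : bmultinom d k.+1 => (a u z, multi_list u)) (index_enum _).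

Lemma diffopE k (a : multinom d -> 'rV[R]_d -> R) F z :
  diffop k a F z =
  dapp z (diffop_list k a z) F.
Proof.
by rewrite /diffop /dapp big_map; apply: eq_bigr => u _; rewrite mpartialE.
Qed.

Lemma holder_ge (r : nat) (g : R) (Om : set 'rV[R]_d) F alpha (x y : 'rV[R]_d) :
  mdeg alpha = r -> Om x -> Om y -> x != y ->
  ((`|dl (multi_list alpha) F x - dl (multi_list alpha) F y| / enorm (x - y) `^ g)%:E <=
  holder r g Om F)%E.
Proof.
move=> ar Ox Oy xy.
have ar' : (mdeg alpha < r.+1)%N by rewrite ar.
pose u : bmultinom d r.+1 := BMultinom ar'.
apply: (@bigmax_sup _ _ _ _ u); first by rewrite /= ar.
rewrite /holder0 le_max; apply/orP; right; apply: ereal_sup_ubound.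
by exists x, y; split=> //; rewrite !mpartialE.
Qed.

Lemma enorm_delta (i : 'I_d) (t : R) : enorm (t *: (delta_mx ord0 i : 'rV[R]_d)) = `|t|.
Proof.
rewrite /enorm (bigD1 i)//= big1 ?addr0 => [|j ji].
  by rewrite !mxE !eqxx mulr1 sqrtr_sqr.
by rewrite !mxE eqxx (negbTE ji) mulr0 expr0n.
Qed.

(** The derivative of order [r] along an axis is a constant times |t|^g, with a change of sign
    across the origin for odd [r]. The points rho and - rho (odd) or rho and 0 (even) then give a
    quotient independent of [rho]. *)
Lemma holder_sphs_ge (n r : nat) (nu g rho : R) : (0 < d)%N ->
  2 * n%:R < nu < 2 * n.+1%:R -> nu = r%:R + g -> 0 < g <= 1 -> 0 < rho ->
  ((axis_seminorm nu g r)%:E <=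
   holder r g [set u : 'rV[R]_d | (enorm u <= rho)%R] (sphs n nu))%E.
Proof.
move=> d0 nub nuE /andP[g0 g1] rho0.
pose i0 : 'I_d := Ordinal d0; pose e : 'rV[R]_d := delta_mx ord0 i0.
pose alpha : multinom d := mnm_muln (mnm1 i0) r.
have degA : mdeg alpha = r by rewrite mdegMn mdeg1 mul1n.
have LE : multi_list alpha = nseq r e.
  rewrite -[in RHS]degA -size_multi_list; apply/all_pred1P/allP => v.
  move=> /flattenP[s /mapP[i _ ->]]; rewrite mulmnE mnm1E.
  case: eqVneq => [<-|_]; last by rewrite mul0n.
  by rewrite mul1n => /nseqP[-> _]; exact: eqxx.
have rnu : r%:R < nu by rewrite nuE ltrDl.
have hs : hspan nu (@sphs R d n nu) by exact: hspan_enorm.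
have CF : Cn r (@sphs R d n nu) by exact: hspan_Cn hs.
have pos t : 0 < t -> dl (nseq r e) (sphs n nu) (t *: e) =
    (-1) ^+ n.+1 * falling nu r * t `^ g.
  move=> t0; have := @dl_line_powR _ _ (sphs n nu) 0 e 1 0 ((-1) ^+ n.+1) nu r CF _ t.
  rewrite !mul1r !addr0 add0r expr1n mulr1 nuE addrAC subrr add0r -nuE => -> //.
  by move=> u; rewrite mul1r addr0 add0r => u0; rewrite /sphs enorm_delta gtr0_norm.
have neg t : 0 < t -> dl (nseq r e) (sphs n nu) ((- t) *: e) =
    (-1) ^+ r * ((-1) ^+ n.+1 * falling nu r * t `^ g).
  move=> t0; have := @dl_line_powR _ _ (sphs n nu) 0 e (-1) 0 ((-1) ^+ n.+1) nu r CF _ (- t).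
  rewrite mulrNN !mul1r !addr0 add0r nuE addrAC subrr add0r -nuE => -> //.
    by ring.
  by move=> u; rewrite mulN1r addr0 add0r oppr_gt0 => u0; rewrite /sphs enorm_delta ltr0_norm.
have sgn : `|(-1) ^+ n.+1| = 1 :> R by rewrite normrX normrN1 expr1n.
have f0 : 0 < falling nu r by apply: falling_gt0; lra.
have e0 : e != 0.
  by apply/eqP => /rowP/(_ i0)/eqP; rewrite !mxE !eqxx oner_eq0.
have rg : 0 < rho `^ g by exact: powR_gt0.
have inpos : enorm (rho *: e) <= rho by rewrite enorm_delta gtr0_norm.
rewrite /axis_seminorm; case: ifP => r_odd.
  apply: (le_trans _ (@holder_ge r g _ (sphs n nu) alpha (rho *: e) (- rho *: e) degA _ _ _)) => //=.
  - rewrite LE pos// neg// lee_fin -scalerBl enorm_delta -(signr_odd _ r) r_odd expr1 mulN1r opprK.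
    rewrite opprK -mulr2n normrMn -mulr2n normrMn !normrM sgn mul1r.
    rewrite (gtr0_norm f0) (gtr0_norm rg) (gtr0_norm rho0) -[rho *+ 2]mulr_natl.
    rewrite powRM ?(ltW rho0)// invfM le_eqVlt; apply/orP; left; apply/eqP.
    rewrite -[X in _ = X * _]mulr_natl; field; apply/andP.
    by rewrite !gt_eqF// powR_gt0.
  - by rewrite enorm_delta normrN gtr0_norm.
  - rewrite -subr_eq0 -scalerBl scaler_eq0 (negbTE e0) orbF opprK gt_eqF// addr_gt0//.
(* The derivative is homogeneous of degree [nu - r], which is positive. *)
have D0 : dl (nseq r e) (sphs n nu) 0 = 0.
  apply: (@hspan0 _ _ (nu - r%:R)); first by rewrite subr_gt0.
  by have := @hspan_dl _ _ (nseq r e) nu (sphs n nu); rewrite size_nseq; exact.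
apply: (le_trans _ (@holder_ge r g _ (sphs n nu) alpha (rho *: e) 0 degA _ _ _)) => //=.
- rewrite LE pos// D0 !subr0 lee_fin enorm_delta !normrM sgn !mul1r.
  rewrite (gtr0_norm f0) (gtr0_norm rg) (gtr0_norm rho0) mulfK// gt_eqF//.
- by rewrite -(scale0r e) enorm_delta normr0 ltW.
- by rewrite scaler_eq0 (negbTE e0) orbF gt_eqF.
Qed.

(** The endpoints [X j] and [z] belong to the star. Most of the proof shows that the distances are
    bounded, so that [sup] in [diam] is an upper bound. *)
Lemma enorm_le_diam (N : nat) (z : 'rV[R]_d) (X : 'I_N -> 'rV[R]_d) j :
  enorm (X j - z) <= diam (star z X).
Proof.
have seg0 : segment z (X j) z by exists 0; rewrite lexx ler01 subr0 scale1r scale0r addr0.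
have seg1 : segment z (X j) (X j) by exists 1; rewrite lexx ler01 subrr scale0r scale1r add0r.
apply: ub_le_sup; last by exists (X j), z; split=> //; exists j.
pose M := \sum_i `|X i - z|.
have starE u : star z X u -> `|u - z| <= M.
  move=> [i [t [/andP[t0 t1] ->]]].
  have -> : (1 - t) *: z + t *: X i - z = t *: (X i - z).
    by rewrite scalerBl scale1r scalerBr addrAC [z - _ - z]addrAC subrr add0r addrC.
  rewrite normrZ ger0_norm// (le_trans (ler_piMl _ t1))//.
  by rewrite /M (bigD1 i)//= lerDl sumr_ge0.
exists (d%:R * (M + M)) => _ [x [y [sx sy ->]]].
rewrite /enorm -powR12_sqrt ?sqn_ge0// (le_trans (enorm_le_norm _))// ler_wpM2l//.
rewrite (_ : x - y = (x - z) - (y - z)); last by rewrite opprB addrA subrK.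
by rewrite (le_trans (ler_normB _ _))// lerD// starE.
Qed.

End AxisSeminorm.

(** * The error functional of the kernel-based formula *)

Section ErrorBound.
Context {R : realType} {d : nat}.

Lemma phsE (n : nat) (nu : R) : 2 * n%:R < nu < 2 * n.+1%:R -> phs nu = @sphs R d n nu.
Proof.
move=> /andP[n1 n2]; apply/funext => x; rewrite /phs /sphs.
rewrite (_ : Num.ceil (nu / 2) = n.+1%:Z)//; apply: ceil_def.
rewrite ltr_pdivlMr// ler_pdivrMr// mulrC [X in _ && (_ <= X)]mulrC (ltW n2) andbT.
by rewrite (_ : n.+1%:Z - 1 = n%:Z)// -addn1 PoszD addrK.
Qed.

(** The set from which [native_norm] picks is nonempty by [is_cvg_native_norm], so the value picked
    is a limit of semi-norms along some approximating sequence and not the default 0. *)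
Lemma native_norm_witness (n s : nat) (nu : R) (f : 'rV[R]_d -> R) :
  2 * n%:R < nu < 2 * n.+1%:R -> (n < s)%N -> native_space (sphs_kernel n nu) s f ->
  exists l p, native_approx (sphs_kernel n nu) s f l p /\
    (fun i => Num.sqrt (ksqnorm (sphs_kernel n nu) (l i))) @ \oo -->
      native_norm (sphs_kernel n nu) s f.
Proof.
move=> nub ns [l [p lp]].
apply: (@xgetPex R 0 [set c : R | exists l p, native_approx (sphs_kernel n nu) s f l p /\
    (fun i => Num.sqrt (ksqnorm (sphs_kernel n nu) (l i))) @ \oo --> c]).
exists (limn (fun i => Num.sqrt (ksqnorm (sphs_kernel n nu) (l i)))).
by exists l, p; split=> //; exact: (is_cvg_native_norm nub ns lp).
Qed.

Variables (n k s N : nat) (nu : R) (a : multinom d -> 'rV[R]_d -> R).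
Variables (z : 'rV[R]_d) (X : 'I_N -> 'rV[R]_d) (w : 'I_N -> R).
Hypothesis nu_bounds : 2 * n%:R < nu < 2 * n.+1%:R.
Hypotheses (kn : (k <= n)%N) (ns : (n < s)%N).
Local Notation K := (@sphs_kernel R d n nu).
Let h := (diffop_list k a z, [seq (- w j, X j) | j <- enum 'I_N]).

Lemma gapp_formula F : gapp z h F = diffop k a F z - \sum_(j < N) w j * F (X j).
Proof.
rewrite /gapp -diffopE /fapply big_map big_enum -sumrN; congr (_ + _).
by apply: eq_bigr => j _; rewrite mulNr.
Qed.

Lemma diffop_list_size c : c \in diffop_list k a z -> (size c.2 <= n)%N.
Proof.
move=> /mapP[u _ ->]; rewrite size_multi_list.
by apply: leq_trans kn; rewrite -ltnS; exact: bmdeg.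
Qed.

Lemma gapp_pfun_sum (I : Type) (r : seq I) (c : I -> R) (q : I -> mpoly d R) g :
  gapp z g (pfun (\sum_(i <- r) c i *: q i)) = \sum_(i <- r) c i * gapp z g (pfun (q i)).
Proof.
rewrite /gapp dapp_pfun_sum; under [RHS]eq_bigr do rewrite mulrDr.
rewrite big_split /=; congr (_ + _).
rewrite /fapply; under [RHS]eq_bigr do rewrite mulr_sumr.
rewrite [RHS]exchange_big; apply: eq_bigr => x _ /=.
rewrite pfun_sum mulr_sumr; apply: eq_bigr => i _.
by rewrite pfunZ; exact: mulrCA.
Qed.

Lemma gapp_kernel_weights M (b : 'I_M -> mpoly d R) q : basis_Pi s b ->
  (forall i, \sum_(j < N) w j * pfun (b i) (X j) = diffop k a (pfun (b i)) z) ->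
  Pi_ s q -> gapp z h (pfun q) = 0.
Proof.
move=> [_ bspan _] wb /bspan[c ->].
by rewrite gapp_pfun_sum big1// => i _; rewrite gapp_formula wb subrr mulr0.
Qed.

Let mu := nu / 2.
Let C := Num.sqrt (2 * (falling (nu - 1) n / n`!%:R)).

Lemma kernel_weights_growth M (b : 'I_M -> mpoly d R) : basis_Pi s b ->
  kernel_weights k a K z X b w ->
  gadm n z h /\ exists q, [/\ Pi_ s q, diffop k a (pfun q) z = gform n nu z h h &
    forall j, `|pfun q (X j)| <= C * enorm (X j - z) `^ mu * Num.sqrt (gform n nu z h h)].
Proof.
move=> bb [v [sys1 sys2]].
have exact q : Pi_ s q -> gapp z h (pfun q) = 0 by exact: gapp_kernel_weights bb sys2.
have hadm : gadm n z h.
  by split=> [c|q qn]; [exact: diffop_list_size|apply: exact; exact: Pi_W qn].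
split=> //.
pose p := \sum_(j < M) v j *: b j.
have [bPi _ _] := bb.
have ps : Pi_ s p by apply: Pi_sum => j _; exact: Pi_Z.
have [|q [qs Dq qX]] := gform_growth nu_bounds ns hadm (exact p ps) ps.
  by move=> j; rewrite -diffopE -sys1 [LHS]addrC addKr pfun_sum; under [RHS]eq_bigr do rewrite pfunZ.
by exists q; split=> //; rewrite diffopE.
Qed.

Lemma growth_ge0 : (0%:E <= growth s k a z X mu)%E.
Proof.
apply: ereal_sup_ubound; exists 0; split=> [|j|].
- by rewrite /Pi_ /= msize0.
- by rewrite /pfun meval0 normr0 powR_ge0.
- rewrite diffopE (_ : (0 : mpoly d R) = \sum_(i <- [::] : seq unit) 0 *: (0 : mpoly d R)).
    by rewrite dapp_pfun_sum big_nil.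
  by rewrite big_nil.
Qed.

Lemma growth_scaled_ge q B : Pi_ s q -> 0 < B ->
  (forall j, `|pfun q (X j)| <= B * enorm (X j - z) `^ mu) ->
  ((diffop k a (pfun q) z / B)%:E <= growth s k a z X mu)%E.
Proof.
move=> qs B0 qX; apply: ereal_sup_ubound; exists (B^-1 *: q); split=> [|j|].
- exact: Pi_Z.
- by rewrite pfunZ normrM normfV (gtr0_norm B0) mulrC ler_pdivrMr// mulrC.
- rewrite !diffopE (_ : B^-1 *: q = \sum_(i <- [:: tt]) B^-1 *: q).
    by rewrite dapp_pfun_sum big_seq1 mulrC.
  by rewrite big_seq1.
Qed.

End ErrorBound.

Theorem corollary3 (R : realType) (d : nat) (d_gt0 : (0 < d)%N)
    (k : nat) (a : multinom d -> 'rV[R]_d -> R)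
    (nu : R) (nu_gt : 2 * k%:R < nu)
    (nu_not_even : forall m : nat, (0 < m)%N -> nu <> (2 * m)%N%:R)
    (s : nat) (s_ge : Num.ceil (nu / 2) <= s%:Z)
    (N : nat) (z : 'rV[R]_d) (X : 'I_N -> 'rV[R]_d) (X_inj : injective X)
    (w_ex : exists w : 'I_N -> R, forall p : mpoly d R, Pi_ s p ->
       \sum_(j < N) w j * pfun p (X j) = diffop k a (pfun p) z)
    (b : 'I_('C(d + s - 1, d)) -> mpoly d R) (b_basis : basis_Pi s b)
    (w : 'I_N -> R)
    (w_kernel : kernel_weights k a (phs_kernel nu) z X b w)
    (r : nat) (r_def : r%:Z = Num.ceil nu - 1)
    (gamma : R) (gamma_def : gamma = nu - r%:R)
    (f : 'rV[R]_d -> R) (f_native : native_space (phs_kernel nu) s f)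
    (growth_fin : (growth s k a z X (nu / 2) < +oo)%E) :
  (`|diffop k a f z - \sum_(j < N) w j * f (X j)|%:E <=
   growth s k a z X (nu / 2) * (Cdr d r gamma `^ (1 / 2))%:E
   * holder r gamma (origin_ball z X) (phs nu) `^ (1 / 2)
   * (native_norm (phs_kernel nu) s f)%:E)%E.

Proof.
have /andP[lo hi] := ceil_itv nu.
have rE : r%:R = (Num.ceil nu - 1)%:~R :> R by rewrite -r_def.
rewrite -rE in lo.
have {}hi : nu <= r%:R + 1.
  by apply: le_trans hi _; rewrite rE intrB subrK.
pose n := r./2.
(* Here r < nu <= r + 1, so only equality on the right, possible for odd [r], is left to
   [nu_not_even]. *)
have nub : 2 * n%:R < nu < 2 * n.+1%:R.
  have rn := odd_double_half r; rewrite -/n -muln2 in rn.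
  have rR : r%:R = (odd r)%:R + 2 * n%:R :> R by rewrite -{1}rn natrD natrM mulrC.
  have odd0 : 0 <= (odd r)%:R :> R by [].
  apply/andP; split; first by lra.
  rewrite lt_neqAle; apply/andP; split.
    by apply/eqP => e; apply: (nu_not_even n.+1) => //; rewrite natrM.
  have odd1 : (odd r)%:R <= 1 :> R by case: (odd r).
  by rewrite -natr1; lra.
have /andP[nlt ltn_] := nub.
have kn : (k <= n)%N.
  have : 2 * k%:R < 2 * n.+1%:R :> R by exact: lt_trans nu_gt ltn_.
  by rewrite ltr_pM2l// ltr_nat ltnS.
have ceilE : Num.ceil (nu / 2) = n.+1%:Z.
  apply: ceil_def; rewrite ltr_pdivlMr// ler_pdivrMr// mulrC [X in _ && (_ <= X)]mulrC (ltW ltn_) andbT.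
  by rewrite (_ : n.+1%:Z - 1 = n%:Z)// -addn1 PoszD addrK.
have ns : (n < s)%N by move: s_ge; rewrite ceilE.
have nuE : nu = r%:R + gamma by rewrite gamma_def addrC subrK.
have g01 : 0 < gamma <= 1 by rewrite gamma_def; apply/andP; split; lra.
have phE : phs_kernel nu = @sphs_kernel R d n nu.
  by rewrite /phs_kernel /sphs_kernel (phsE nub).
rewrite phE in w_kernel f_native *; rewrite (phsE nub).
have [l [p [lp lc]]] := native_norm_witness nub ns f_native.
set c := native_norm _ _ _ in lc *.
have c0 : 0 <= c by apply: (cvgr_to_ge lc); apply: nearW => i; exact: sqrtr_ge0.
have [hadm [q [qs Dq qX]]] := kernel_weights_growth nub kn ns b_basis w_kernel.
have [v [_ sys2]] := w_kernel.
set h := (_, _) in hadm Dq qX.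
pose P := Num.sqrt (gform n nu z h h).
have P0 : 0 <= P by exact: sqrtr_ge0.
have PP : gform n nu z h h = P ^+ 2 by rewrite sqr_sqrtr//; exact: gform_psd.
rewrite PP in Dq; rewrite -/P in qX.
have err : `|diffop k a f z - \sum_(j < N) w j * f (X j)| <= P * c.
  rewrite -gapp_formula; apply: (gapp_native_le nub ns lp) => //.
  by move=> q' q's; exact: gapp_kernel_weights b_basis sys2 q's.
have rho_ge0 : (0%:E <= growth s k a z X (nu / 2))%E by exact: growth_ge0.
set C := Num.sqrt _ in qX.
have C2_gt0 : 0 < 2 * (falling (nu - 1) n / n`!%:R).
  rewrite mulr_gt0// divr_gt0 ?ltr0n ?fact_gt0//; apply: falling_gt0.
  have : 0 <= n%:R :> R by [].
  by move: nlt; case: (n) => [|n']; rewrite -?natr1; lra.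
have C0 : 0 < C by rewrite sqrtr_gt0.
have rhoE : growth s k a z X (nu / 2) = (fine (growth s k a z X (nu / 2)))%:E.
  by rewrite fineK// ge0_fin_numE.
move: rho_ge0; rewrite rhoE lee_fin; set rho := fine _ => rho0.
have scaled B : 0 < B -> (forall j, `|pfun q (X j)| <= B * enorm (X j - z) `^ (nu / 2)) ->
    P ^+ 2 / B <= rho.
  move=> B0 qB; have := growth_scaled_ge k a qs B0 qB.
  by rewrite Dq rhoE lee_fin.
apply: (@le_trans _ _ (P * c)%:E); first by rewrite lee_fin.
rewrite EFinM.
apply: lee_wpmul2r; first by rewrite lee_fin.
(* If all nodes equal [z], the star has no extent and gives no positive radius, so [P] = 0 is shown
   directly from the finiteness of the growth function. *)
have [allz|/existsNP[j0 /eqP Xj0]] := pselect (forall j, X j = z).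
  have -> : P = 0.
    apply/eqP; rewrite -sqrf_eq0; apply/negP => /negP P2.
    have P2' : 0 < P ^+ 2 by rewrite lt0r P2 sqr_ge0.
    have rho1 : 0 < rho + 1 by rewrite ltr_wpDl.
    (* All the bounds at the nodes are 0, so any positive scaling is allowed; this one would give
       rho + 1 <= rho. *)
    have := scaled (P ^+ 2 / (rho + 1)); rewrite divr_gt0// => /(_ isT).
    rewrite invfM invrK mulrA mulfV ?mul1r// => H.
    have /H : forall j, `|pfun q (X j)| <= P ^+ 2 / (rho + 1) * enorm (X j - z) `^ (nu / 2).
      move=> j; apply: (le_trans (qX j)).
      have -> : enorm (X j - z) `^ (nu / 2) = 0.
        have nu0 := nu_gt0 nub.
        rewrite enorm_powR allz subrr (eqP (_ : sqn (0 : 'rV[R]_d) == 0)) ?sqn_eq0//.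
        by rewrite powR0// !mulf_neq0 ?gt_eqF ?invr_gt0.
      by rewrite !mulr0 mul0r.
    by rewrite leNgt ltrDl ltr01.
  by rewrite !mule_ge0 ?lee_fin ?powR_ge0 ?poweR_ge0.
have Ple : P <= C * rho.
  have [->|P_neq0] := eqVneq P 0; first by rewrite mulr_ge0// ltW.
  have Pgt0 : 0 < P by rewrite lt0r P_neq0.
  (* After scaling by [C * P] the polynomial is admissible, and its value P^2 becomes P / C. *)
  have := scaled (C * P); rewrite mulr_gt0// => /(_ isT).
  have E : P ^+ 2 / (C * P) = P / C by field; rewrite !gt_eqF.
  rewrite E ler_pdivrMr// [rho * C]mulrC; apply=> j.
  by rewrite mulrAC; exact: qX.
(* A node different from [z] gives the ball a positive radius, which allows the axis points of
   [holder_sphs_ge]. *)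
have diam0 : 0 < diam (star z X).
  apply: lt_le_trans (enorm_le_diam z X j0).
  by rewrite sqrtr_gt0 -/(sqn _) sqn_gt0 subr_eq0.
have H0 := holder_sphs_ge d_gt0 nub nuE g01 diam0.
have Cle := falling_le_Cdr d_gt0 nuE g01; rewrite -/n in Cle.
set H := axis_seminorm _ _ _ in H0 Cle.
have H0' : 0 <= H.
  have /andP[g0 _] := g01.
  rewrite /H /axis_seminorm mulr_ge0//; first by case: ifP => // _; rewrite divr_ge0 ?powR_ge0.
  by rewrite ltW// falling_gt0//; lra.
have Cdr0 : 0 <= Cdr d r gamma.
  have /andP[g0 _] := g01.
  rewrite /Cdr; case: ifP => _; rewrite divr_ge0 ?mulr_ge0 ?powR_ge0//;
    by apply: prodr_ge0 => i _; exact: sqr_ge0.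
have CH : C <= Cdr d r gamma `^ (1 / 2) * H `^ (1 / 2).
  by rewrite -powRM// mul1r powR12_sqrt; [exact: ler_wsqrtr|exact: mulr_ge0].
apply: (@le_trans _ _ (rho%:E * (Cdr d r gamma `^ (1 / 2))%:E * (H `^ (1 / 2))%:E)%E).
  by rewrite -!EFinM lee_fin (le_trans Ple)// mulrC -mulrA ler_wpM2l.
apply: lee_wpmul2l; first by rewrite -EFinM lee_fin mulr_ge0// powR_ge0.
rewrite -poweR_EFin; apply: gt0_ler_poweR => //; rewrite ?in_itv /= ?lee_fin ?H0' ?leey//.
by rewrite andbT (le_trans _ H0)// lee_fin.
Qed.
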